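(* Let $P$ be a set of pointers and let $\pi\in S_n$ be $P$-good, with $|\mathrm{SP}(\pi)|=k$. Write $c=k-|P|$. Assume $|P|>3c$, and let $A\subset\mathrm{SP}(\pi)$ satisfy $|A|\ge\lfloor k/2\rfloor+1+2c$. Then ONE has a winning strategy in $\mathbf{CDS}(\pi,A)$.
   Context: Permutations $\pi\in S_n$ are written $[\pi(1)\ \cdots\ \pi(n)]$. Entry $k$ has left pointer $(k-1,k)$ and right pointer $(k,k+1)$; the pointer $(p,p+1)$ is written $p^*$. The pointer word $W(\pi)$ lists $L(\pi(1))R(\pi(1))\cdots L(\pi(n))R(\pi(n))$ with $(0,1)$ and $(n,n+1)$ removed. Two distinct pointers $p,q$ are compatible (form a valid pointer context) if their occurrences in $W(\pi)$ interleave: $p\ldots q\ldots p\ldots q$ or $q\ldots p\ldots q\ldots p$. For a valid pointer context $(p,q)$, $\mathbf{cds}_{p,q}(\pi)$ is obtained by swapping the block of entries of $\pi$ lying between the first occurrences of $p$ and $q$ in $W(\pi)$ with the block lying between their second occurrences. A pointer $r^*$ is part of an adjacency if $r+1$ immediately follows $r$ in $\pi$. A cds fixed point is a permutation with no valid pointer context; the non-identity ones are $\sigma_{n,p}=[p+1\ \cdots\ n\ 1\ \cdots\ p]$ (so $\sigma_{n,p}(n)=p$). Strategic pile: with $X_n=(0\ 1\ \cdots\ n)$, $Y_\pi=(\pi(n)\ \cdots\ \pi(1)\ 0)$ in cycle notation and $C_\pi=Y_\pi\circ X_n$, $\mathrm{SP}(\pi)$ is the set of numbers after $n$ and before $0$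 in the cycle of $C_\pi$ containing $0$ and $n$; a pointer $p^*$ is identified with the number $p$. The game $\mathbf{CDS}(\pi,A)$, $A\subseteq\mathrm{SP}(\pi)$: players ONE and TWO, starting with ONE, alternately apply $\mathbf{cds}$ at a valid pointer context of the current permutation until a fixed point is reached; ONE wins iff the fixed point is $\sigma_{n,a}$ for some $a\in A$. For a set $P$ of pointers, $\pi$ is $P$-good if (1) every two pointers in $P$ are compatible, (2) for all $p,q\in P$ and any other pointer $r$, $r$ is compatible with $p$ iff $r$ is compatible with $q$, and (3) every pointer $p^*$ not part of an adjacency has $p\in\mathrm{SP}(\pi)$.
   Formalization: Here c is read as max(k−|P|, 0); this excludes only the case where π is the identity, |P|=1, k=0 and A is empty, in which a negative c would satisfy every hypothesis although ONE does not win. *)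

(* Defs.v *)
From mathcomp Require Import all_boot all_fingroup.

Set Implicit Arguments.
Unset Strict Implicit.
Unset Printing Implicit Defensive.

(* One-line notation [pi(1) ... pi(n)] with entries in {1, ..., n}.  The
   functions below act on such words w, with n = size w. *)
Definition oneline (n : nat) (pi : 'S_n) : seq nat :=
  [seq (val (pi i)).+1 | i <- enum 'I_n].

(* The pointer p^* = (p, p + 1) is represented by the number p, so the entry e
   has left pointer e.-1 and right pointer e. *)
Definition is_pointer (n p : nat) : bool := 0 < p < n.

Definition pointers (n : nat) : {set 'I_n.+1} :=
  [set p : 'I_n.+1 | is_pointer n p].

Definition full_pointer_word (w : seq nat) : seq nat :=
  flatten [seq [:: e.-1; e] | e <- w].

Definition pointer_word (w : seq nat) : seq nat :=
  [seq p <- full_pointer_word w | is_pointer (size w) p].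

(* This is false when p = q, or when p or q is not a pointer, because every
   pointer occurs exactly twice in the pointer word. *)
Definition compatible (w : seq nat) (p q : nat) : bool :=
  [seq x <- pointer_word w | x \in [:: p; q]]
    \in [:: [:: p; q; p; q]; [:: q; p; q; p]].

(* Number of entries of w preceding the first (resp. second) occurrence of the
   pointer p: position m of the full pointer word is the left (m even) or the
   right (m odd) side of entry number m./2, so uphalf m entries precede it. *)
Definition first_cut (w : seq nat) (p : nat) : nat :=
  uphalf (index p (full_pointer_word w)).

Definition second_cut (w : seq nat) (p : nat) : nat :=
  let W := full_pointer_word w in
  let i := (index p W).+1 in
  uphalf (i + index p (drop i W)).

Definition cds (p q : nat) (w : seq nat) : seq nat :=
  let a := minn (first_cut w p) (first_cut w q) in
  let b := maxn (first_cut w p) (first_cut w q) in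
  let c := minn (second_cut w p) (second_cut w q) in
  let d := maxn (second_cut w p) (second_cut w q) in
  take a w ++ drop c (take d w) ++ drop b (take c w) ++ drop a (take b w)
    ++ drop d w.

Definition part_of_adjacency (w : seq nat) (r : nat) : bool :=
  infix [:: r; r.+1] w.

Definition cds_fixed_point (w : seq nat) : Prop :=
  forall p q : nat, ~~ compatible w p q.

Definition sigma (n p : nat) : seq nat := iota p.+1 (n - p) ++ iota 1 p.

(* next s is the cyclic permutation written s in cycle notation. *)
Definition X_cycle (n : nat) : nat -> nat := next (iota 0 n.+1).

Definition Y_cycle (w : seq nat) : nat -> nat := next (rcons (rev w) 0).

Definition C_perm (w : seq nat) : nat -> nat :=
  Y_cycle w \o X_cycle (size w).

(* The trajectory of n under C_perm, of length n + 1, runs through the whole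
   cycle of n.  The strategic pile is empty if 0 is not in that cycle. *)
Definition strategic_seq (w : seq nat) : seq nat :=
  let s := traject (C_perm w) (size w) (size w).+1 in
  if 0 \in s then behead (take (index 0 s) s) else [::].

Definition SP (n : nat) (pi : 'S_n) : {set 'I_n.+1} :=
  [set x : 'I_n.+1 | val x \in strategic_seq (oneline pi)].

Definition good (n : nat) (P : {set 'I_n.+1}) (pi : 'S_n) : Prop :=
  [/\ forall p q : 'I_n.+1, p \in P -> q \in P -> p != q ->
        compatible (oneline pi) p q,
      forall p q r : 'I_n.+1, p \in P -> q \in P ->
        r \in pointers n -> r != p -> r != q ->
        compatible (oneline pi) r p = compatible (oneline pi) r q
    & forall p : 'I_n.+1, p \in pointers n ->
        ~~ part_of_adjacency (oneline pi) p -> p \in SP pi].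

(* A history is the sequence of the pointer contexts played so far, oldest
   first; ONE makes the moves with even index 0, 2, 4, ... *)
Definition history := seq (nat * nat).

Definition position (w : seq nat) (h : history) : seq nat :=
  foldl (fun v m => cds m.1 m.2 v) w h.

Fixpoint legal (w : seq nat) (h : history) : bool :=
  if h is m :: h' then compatible w m.1 m.2 && legal (cds m.1 m.2 w) h'
  else true.

Definition strategy := history -> nat * nat.

Definition follows (f : strategy) (h : history) : Prop :=
  forall i : nat, i < size h -> ~~ odd i -> nth (0, 0) h i = f (take i h).

(* Every cds move increases the number of adjacencies, so there are no infinite
   plays to be taken into account. *)
Definition winning_strategy (n : nat) (pi : 'S_n) (A : {set 'I_n.+1})
    (f : strategy) : Prop :=
  forall h : history, legal (oneline pi) h -> follows f h ->
    let v := position (oneline pi) h in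
    (cds_fixed_point v -> exists2 a : 'I_n.+1, a \in A & v = sigma n a) /\
    (~ cds_fixed_point v -> ~~ odd (size h) -> compatible v (f h).1 (f h).2).

Definition ONE_has_winning_strategy (n : nat) (pi : 'S_n)
    (A : {set 'I_n.+1}) : Prop :=
  exists f : strategy, winning_strategy pi A f.

(* Main.v *)
Require Import Defs.
From mathcomp Require Import all_boot all_fingroup.
From mathcomp Require Import zify.
From Stdlib Require Import ClassicalEpsilon.

Set Implicit Arguments.
Unset Strict Implicit.
Unset Printing Implicit Defensive.

(* Writing [n] for the size of the permutation, a move at [(p, q)] deletes [p] and
   [q] from their cycles in [C_perm], and acts on the overlap graph of the pointers
   as the Schur complement over F_2 of the edge [p]-[q]. Condition (3) of goodness
   says that, apart from fixed points, [C_perm] is a single cycle through [0] and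
   [n], with [n] the image of [0]; this persists, so that the pointers still alive
   are exactly those of the strategic pile that have not been played, and the game
   ends when one of them is left. The remaining part of [P] stays a clique of twins.
   Such a position has a connected overlap graph: all degrees are even, an isolated
   live pointer is the only one, and deleting pairs of [P] does not affect the rest
   of the graph. Hence, while some live pointer is outside [P], ONE can delete one
   of them together with a pointer of [P]: this takes at most [c] rounds, each of
   which costs at most 3 pointers of [P]. Afterwards the graph is a clique, and ONE
   deletes two pointers outside [A] at each turn. *)

(** * Positions of the entries *)

Definition rpos (w : seq nat) (x : nat) : nat := index x (0 :: w).

(* The entry [0] also ends the word, as the successor of the entry [n]. *)
Definition lpos (w : seq nat) (x : nat) : nat :=
  if x == size w then (size w).+1 else index x.+1 (0 :: w).

(** Parity of the comparisons between the occurrences of [p] and of [q], odd exactly when they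
    interleave; no order of the two occurrences of one pointer has to be known. The [<=] is there
    because the left pointer of an entry precedes its right pointer. *)
Definition cross (w : seq nat) (p q : nat) : bool :=
  [&& is_pointer (size w) p, is_pointer (size w) q, p != q &
      (rpos w p < rpos w q) (+) (rpos w p < lpos w q)
      (+) (lpos w p <= rpos w q) (+) (lpos w p < lpos w q)].

Section Word.
Variables (n : nat) (w : seq nat).
Hypothesis pw : perm_eq w (iota 1 n).

Lemma word_size : size w = n.
Proof. by rewrite (perm_size pw) size_iota. Qed.

Lemma word_mem x : (x \in w) = (0 < x <= n).
Proof. by rewrite (perm_mem pw) mem_iota add1n ltnS. Qed.

Lemma word_uniq : uniq w.
Proof. by rewrite (perm_uniq pw) iota_uniq. Qed.

Lemma word0_mem x : (x \in 0 :: w) = (x <= n).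
Proof. by rewrite inE word_mem; case: x. Qed.

Lemma word0_uniq : uniq (0 :: w).
Proof. by rewrite /= word_mem word_uniq. Qed.

Lemma rpos_le x : x <= n -> rpos w x <= n.
Proof. by move=> le_xn; rewrite -ltnS -word_size (index_mem x (0 :: w)) word0_mem. Qed.

Lemma rpos_gt0 x : 0 < x -> 0 < rpos w x.
Proof. by case: x. Qed.

Lemma rpos_inj x y : x <= n -> y <= n -> rpos w x = rpos w y -> x = y.
Proof. by rewrite -!word0_mem; apply: index_inj. Qed.

Lemma lposE x : x < n -> lpos w x = rpos w x.+1.
Proof. by rewrite /lpos word_size => /ltn_eqF ->. Qed.

Lemma lpos_n : lpos w n = n.+1.
Proof. by rewrite /lpos word_size eqxx. Qed.

Lemma lpos_gt0 x : 0 < lpos w x.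
Proof. by rewrite /lpos; case: ifP => // _; apply: rpos_gt0. Qed.

Lemma lpos_le x : x <= n -> lpos w x <= n.+1.
Proof.
rewrite leq_eqVlt => /orP[/eqP-> | lt_xn]; first by rewrite lpos_n.
by rewrite lposE // ltnW // ltnS rpos_le.
Qed.

Lemma lpos_inj x y : x <= n -> y <= n -> lpos w x = lpos w y -> x = y.
Proof.
rewrite leq_eqVlt => /orP[/eqP-> | lt_xn];
  rewrite leq_eqVlt => /orP[/eqP-> | lt_yn] //.
- rewrite lpos_n lposE // => e; have := rpos_le lt_yn; lia.
- rewrite lpos_n lposE // => e; have := rpos_le lt_xn; lia.
by rewrite !lposE // => /(rpos_inj lt_xn lt_yn) [].
Qed.

(** [X_cycle] takes [x] to its successor and [Y_cycle] steps left in the cyclic word [0 :: w]: the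
    image of [x] is the entry just before [x + 1]. With [0] counted again at position [n + 1], this
    needs no wraparound. *)
Lemma C_permE x y : x <= n -> y <= n ->
  (C_perm w x == y) = (lpos w x == (rpos w y).+1).
Proof.
move=> le_xn le_yn; have Uw := word0_uniq.
have -> : C_perm w x = prev (0 :: w) (if x == n then 0 else x.+1).
  rewrite -[LHS]/(next (rcons (rev w) 0) (next (iota 0 (size w).+1) x)).
  rewrite word_size -rev_cons next_rev //; congr prev.
  rewrite next_nth mem_iota add0n ltnS le_xn [iota 0 _]/=.
  have -> : index x (0 :: iota 1 n) = x.
    have {1}<- : nth 0 (iota 0 n.+1) x = x by rewrite nth_iota.
    by rewrite index_uniq ?(iota_uniq 0 n.+1) ?size_iota.
  have [->|neq] := eqVneq x n; first by rewrite nth_default ?size_iota.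
  by rewrite nth_iota ?add1n // ltn_neqAle neq.
have -> : (prev (0 :: w) (if x == n then 0 else x.+1) == y)
        = ((if x == n then 0 else x.+1) == next (0 :: w) y).
  by apply/eqP/eqP => [<-|->]; rewrite ?next_prev ?prev_next.
rewrite next_nth word0_mem le_yn -/(rpos w y) /lpos word_size.
have := rpos_le le_yn; rewrite leq_eqVlt => /orP[/eqP ry | ry].
  rewrite ry nth_default ?word_size //; case: (eqVneq x n) => [_ | neq];
    first by rewrite !eqxx.
  have lt_xn : x < n by rewrite ltn_neqAle neq.
  have := rpos_le lt_xn; rewrite /rpos; lia.
have nw : nth 0 w (rpos w y) \in w by rewrite mem_nth ?word_size.
case: (eqVneq x n) => [_ | neq].
  by move: nw; rewrite word_mem eqSS (gtn_eqF ry); case: (nth _ _ _).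
rewrite /= eqSS; apply/eqP/eqP => [->|<-];
  first by rewrite index_uniq ?word_size ?word_uniq.
by rewrite nth_index // word_mem /= ltn_neqAle neq.
Qed.

Lemma C_perm_le x : x <= n -> C_perm w x <= n.
Proof.
move=> le_xn; rewrite -word0_mem.
rewrite -[C_perm w x]/(next (rcons (rev w) 0) (next (iota 0 (size w).+1) x)).
have leE y : (y <= n) = (y \in iota 0 n.+1) by rewrite mem_iota.
by rewrite word_size -(mem_rev (0 :: w)) rev_cons mem_next -rev_cons mem_rev
           word0_mem leE mem_next -leE.
Qed.

Lemma C_perm_lpos x : x <= n -> lpos w x = (rpos w (C_perm w x)).+1.
Proof. by move=> le_xn; apply/eqP; rewrite -C_permE ?C_perm_le. Qed.

Lemma C_perm_inj x y : x <= n -> y <= n -> C_perm w x = C_perm w y -> x = y.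
Proof. by move=> ? ? e; apply: lpos_inj; rewrite ?C_perm_lpos ?e. Qed.

End Word.

(** * The pointer word *)

Lemma size_full_pointer_word w : size (full_pointer_word w) = (size w).*2.
Proof. by elim: w => //= e w ->; rewrite doubleS. Qed.

Lemma nth_full_pointer_word w m :
  nth 0 (full_pointer_word w) m =
  if odd m then nth 0 w m./2 else (nth 0 w m./2).-1.
Proof.
elim: w m => [|e w IHw] [|[|m]] //=; first by rewrite if_same.
by rewrite negbK IHw.
Qed.

Lemma index_min (x : nat) (s : seq nat) (i : nat) :
  i < size s -> nth 0 s i = x -> (forall j, j < i -> nth 0 s j != x) ->
  index x s = i.
Proof.
move=> lt_is nx ltP; apply/eqP; rewrite eqn_leq -{1}nx index_nth // leqNgt.
apply/negP => /ltP/eqP[]; apply: nth_index.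
by rewrite -nx mem_nth.
Qed.

Lemma filter_nth_iota (T : Type) (x0 : T) (a : pred T) (s : seq T) :
  filter a s = [seq nth x0 s i | i <- iota 0 (size s) & a (nth x0 s i)].
Proof. by rewrite -{1}(mkseq_nth x0 s) /mkseq filter_map. Qed.

Lemma filter_iota_sorted (a : pred nat) (N : nat) (s : seq nat) :
  sorted ltn s -> (forall i, (i \in s) = (i < N) && a i) ->
  filter a (iota 0 N) = s.
Proof.
move=> ss sP; apply: (irr_sorted_eq ltn_trans ltnn) => //.
  by rewrite sorted_filter ?iota_ltn_sorted //; apply: ltn_trans.
by move=> i; rewrite mem_filter mem_iota sP /= add0n andbC.
Qed.

(* Positions in the full pointer word of the right pointer of the entry [p] and
   of the left pointer of the entry [p.+1]. *)
Definition rocc (w : seq nat) (p : nat) : nat := (rpos w p).*2.-1.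
Definition locc (w : seq nat) (p : nat) : nat := (lpos w p).-1.*2.

Lemma interleave_addb_aux (a b c d : nat) : a < b -> c < d ->
  a != c -> a != d -> b != c -> b != d ->
  (a < c) (+) (a < d) (+) (b < c) (+) (b < d) =
  (a < c < b) && (b < d) || (c < a < d) && (d < b).
Proof.
move=> ab cd; case: (ltngtP a c) => // o1 _; case: (ltngtP a d) => // o2 _;
  case: (ltngtP b c) => // o3 _; case: (ltngtP b d) => // o4 _; exfalso; lia.
Qed.
(** The sum is symmetric in [a, b] and in [c, d], so both pairs may be taken increasing. *)
Lemma interleave_addb (a b c d : nat) : a != b -> c != d ->
  a != c -> a != d -> b != c -> b != d ->
  (a < c) (+) (a < d) (+) (b < c) (+) (b < d) =
  (minn a b < minn c d < maxn a b) && (maxn a b < maxn c d)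
  || (minn c d < minn a b < maxn c d) && (maxn c d < maxn a b).
Proof.
move=> nab ncd nac nad nbc nbd; rewrite /minn /maxn.
case: (ltngtP a b) nab => // ab _; case: (ltngtP c d) ncd => // cd _;
 rewrite -interleave_addb_aux //.
all: by do 4!case: (_ < _).
Qed.

Section Pointers.
Variables (n : nat) (w : seq nat).
Hypothesis pw : perm_eq w (iota 1 n).
Local Notation W := (full_pointer_word w).

Lemma pointer_occ p i : is_pointer n p -> i < size W ->
  (nth 0 W i == p) = (i \in [:: rocc w p; locc w p]).
Proof.
move=> /andP[p_gt0 lt_pn]; rewrite size_full_pointer_word (word_size pw) => lt_iW.
rewrite nth_full_pointer_word /rocc /locc (lposE pw) // /rpos /= !inE.
have -> : (0 == p) = false by rewrite ltn_eqF.
have lt_in : i./2 < size w by rewrite (word_size pw); lia.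
have nE x : 0 < x <= n -> (nth 0 w i./2 == x) = (i./2 == index x w).
  move=> xn; apply/eqP/eqP => [<-|->]; first by rewrite index_uniq ?(word_uniq pw).
  by rewrite nth_index ?(word_mem pw).
have ni : nth 0 w i./2 \in w by rewrite mem_nth.
have := odd_double_half i.
case: (odd i) => /= i2.
  rewrite nE; lia.
have -> : ((nth 0 w i./2).-1 == p) = (nth 0 w i./2 == p.+1).
  by move: ni; rewrite (word_mem pw); case: (nth _ _ _).
rewrite nE; lia.
Qed.

Lemma occ_lt p : is_pointer n p -> (rocc w p < size W) && (locc w p < size W).
Proof.
move=> /andP[p_gt0 lt_pn]; rewrite size_full_pointer_word (word_size pw).
have := rpos_le pw (ltnW lt_pn); have := rpos_le pw lt_pn.
rewrite /rocc /locc (lposE pw) //.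
have := rpos_gt0 w p_gt0; have := rpos_gt0 w (ltn0Sn p); lia.
Qed.

Lemma first_cutE p : is_pointer n p ->
  first_cut w p = minn (rpos w p) (lpos w p).-1.
Proof.
move=> pp; have /andP[rW lW] := occ_lt pp; have /andP[p_gt0 lt_pn] := pp.
rewrite /first_cut (@index_min p W (minn (rocc w p) (locc w p))).
- rewrite /rocc /locc; have := rpos_gt0 w p_gt0; lia.
- lia.
- apply/eqP; rewrite pointer_occ // ?inE; lia.
move=> j lt_j; rewrite pointer_occ // ?inE; lia.
Qed.

Lemma second_cutE p : is_pointer n p ->
  second_cut w p = maxn (rpos w p) (lpos w p).-1.
Proof.
move=> pp; have /andP[rW lW] := occ_lt pp; have /andP[p_gt0 lt_pn] := pp.
have ne : rocc w p != locc w p by rewrite /rocc /locc; have := rpos_gt0 w p_gt0; lia.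
rewrite /second_cut (@index_min p W (minn (rocc w p) (locc w p))); first last.
- move=> j lt_j; rewrite pointer_occ // ?inE; lia.
- apply/eqP; rewrite pointer_occ // ?inE; lia.
- lia.
rewrite (@index_min p _ (maxn (rocc w p) (locc w p) - (minn (rocc w p) (locc w p)).+1)).
- rewrite /rocc /locc; have := rpos_gt0 w p_gt0; move: ne; rewrite /rocc /locc; lia.
- rewrite size_drop; lia.
- apply/eqP; rewrite nth_drop pointer_occ // ?inE; lia.
move=> j lt_j; rewrite nth_drop pointer_occ // ?inE; lia.
Qed.

Lemma filter_pointer_word p q : is_pointer n p -> is_pointer n q ->
  [seq x <- pointer_word w | x \in [:: p; q]] = [seq x <- W | x \in [:: p; q]].
Proof.
move=> pp qp; rewrite /pointer_word -filter_predI; apply: eq_filter => x /=.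
rewrite (word_size pw) !inE.
by case: eqVneq => [->|_] /=; rewrite ?pp //; case: eqVneq => [->|_].
Qed.

Lemma filter_pointers_sorted p q s : is_pointer n p -> is_pointer n q ->
  sorted ltn s -> s =i [:: rocc w p; locc w p; rocc w q; locc w q] ->
  [seq x <- pointer_word w | x \in [:: p; q]] = [seq nth 0 W i | i <- s].
Proof.
move=> pp qp ss sE; rewrite filter_pointer_word // (filter_nth_iota 0).
congr map; apply: filter_iota_sorted => // i.
have := occ_lt pp; have := occ_lt qp => ltq ltp.
rewrite sE; case: (ltnP i (size W)) => [ltiW|leWi] /=.
  by rewrite !inE !pointer_occ // !inE !orbA.
rewrite !inE; lia.
Qed.

Lemma nth_rocc p : is_pointer n p -> nth 0 W (rocc w p) = p.
Proof.
by move=> pp; apply/eqP; rewrite pointer_occ ?inE ?eqxx //; case/andP: (occ_lt pp).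
Qed.

Lemma nth_locc p : is_pointer n p -> nth 0 W (locc w p) = p.
Proof.
by move=> pp; apply/eqP; rewrite pointer_occ ?inE ?eqxx ?orbT //;
  case/andP: (occ_lt pp).
Qed.

Lemma compatible_pointer p q : compatible w p q ->
  [/\ is_pointer n p, is_pointer n q & p != q].
Proof.
move=> cpq; set s := [seq x <- pointer_word w | x \in [:: p; q]].
have sE : s =i [:: p; q].
  by move: cpq; rewrite /compatible -/s !inE => /orP[]/eqP-> x; rewrite !inE;
    do 2!case: eqP.
have sub x : x \in s -> is_pointer n x.
  by rewrite !mem_filter (word_size pw) => /and3P[].
have pp : is_pointer n p by rewrite sub // sE mem_head.
have qp : is_pointer n q by rewrite sub // sE !inE eqxx orbT.
split=> //; apply/negP => /eqP epq; subst q.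
have /andP[p_gt0 lt_pn] := pp.
have ne : rocc w p != locc w p by rewrite /rocc /locc; have := rpos_gt0 w p_gt0; lia.
(* For [q = p] only two occurrences remain, whereas the pattern has length 4. *)
have : size s = 2.
  rewrite /s (@filter_pointers_sorted _ _ [:: minn (rocc w p) (locc w p);
    maxn (rocc w p) (locc w p)]) //.
    by rewrite /= andbT; lia.
  by move=> i; rewrite !inE; lia.
by move: cpq; rewrite /compatible -/s !inE => /orP[]/eqP->.
Qed.

Lemma compatibleE p q : compatible w p q = cross w p q.
Proof.
have [/and3P[pp qp npq] | ] := boolP [&& is_pointer n p, is_pointer n q & p != q];
  last first.
  rewrite /cross (word_size pw) => npq;
    apply/idP/and4P => [/compatible_pointer[pp qp ne] | [pp qp ne _]];
  by rewrite pp qp ne in npq.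
rewrite /cross (word_size pw) pp qp npq /=.
have /andP[p_gt0 lt_pn] := pp; have /andP[q_gt0 lt_qn] := qp.
have rp := rpos_gt0 w p_gt0; have rq := rpos_gt0 w q_gt0.
have lp := lpos_gt0 w p; have lq := lpos_gt0 w q.
have nrr : rpos w p != rpos w q.
  by apply: contraNneq npq => /(rpos_inj pw (ltnW lt_pn) (ltnW lt_qn)) ->.
have nll : lpos w p != lpos w q.
  by apply: contraNneq npq => /(lpos_inj pw (ltnW lt_pn) (ltnW lt_qn)) ->.
(* First and second occurrence of [x] in the full pointer word. *)
pose f x := minn (rocc w x) (locc w x); pose s x := maxn (rocc w x) (locc w x).
have nf x : is_pointer n x -> nth 0 W (f x) = x.
  by move=> xp; rewrite /f /minn; case: ifP; rewrite ?nth_rocc ?nth_locc.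
have ns x : is_pointer n x -> nth 0 W (s x) = x.
  by move=> xp; rewrite /s /maxn; case: ifP; rewrite ?nth_rocc ?nth_locc.
have fsE (t : seq nat) :
    t =i [:: f p; s p; f q; s q] -> t =i [:: rocc w p; locc w p; rocc w q; locc w q].
  move=> tE i; rewrite tE !inE /f /s.
  by rewrite /minn /maxn; do 2![case: ifP => _]; do 4!case: eqP => _.
have npq' := negbTE npq; have nqp' : (q == p) = false by rewrite eq_sym.
have key (t : seq nat) : sorted ltn t -> t =i [:: f p; s p; f q; s q] ->
    compatible w p q = ([seq nth 0 W i | i <- t] \in [:: [:: p; q; p; q]; [:: q; p; q;
      p]]).
  by move=> st tE; rewrite /compatible (filter_pointers_sorted pp qp st (fsE _ tE)).
have fsp : f p < s p by rewrite /f /s /rocc /locc; lia.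
have fsq : f q < s q by rewrite /f /s /rocc /locc; lia.
have d1 : f p != f q by rewrite /f /rocc /locc; lia.
have d2 : f p != s q by rewrite /f /s /rocc /locc; lia.
have d3 : s p != f q by rewrite /f /s /rocc /locc; lia.
have d4 : s p != s q by rewrite /s /rocc /locc; lia.
have -> : (rpos w p < rpos w q) (+) (rpos w p < lpos w q)
      (+) (lpos w p <= rpos w q) (+) (lpos w p < lpos w q)
      = (f p < f q < s p) && (s p < s q) || (f q < f p < s q) && (s q < s p).
  have nr : rocc w p != rocc w q by rewrite /rocc; lia.
  have nl : locc w p != locc w q by rewrite /locc; lia.
  have nrl x y : 0 < rpos w x -> rocc w x != locc w y by rewrite /rocc /locc; lia.
  rewrite /f /s -(@interleave_addb (rocc w p) (locc w p) (rocc w q) (locc w q)) ?nrl //.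
    by congr (_ (+) _ (+) _ (+) _); rewrite /rocc /locc; lia.
  by rewrite eq_sym nrl.
clearbody f s; clear - key nf ns pp qp npq' nqp' fsp fsq d1 d2 d3 d4.
case: (ltngtP (f p) (f q)) d1 => // o1 _; case: (ltngtP (f p) (s q)) d2 => // o2 _;
  case: (ltngtP (s p) (f q)) d3 => // o3 _; case: (ltngtP (s p) (s q)) d4 => // o4 _;
  rewrite /=; try (exfalso; lia).
(* In each of the six possible orders, the sorted list of the four occurrences determines the
   filtered word. *)
all: let go t := rewrite (key t);
  [ by rewrite /= ?nf ?ns // !inE !eqseq_cons ?eqxx ?npq' ?nqp' ?andbF
  | by rewrite /= ?fsp ?fsq ?o1 ?o2 ?o3 ?o4
  | by move=> i; rewrite !inE; do 4!case: eqP => _ ] in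
  first [ go [:: f p; s p; f q; s q] | go [:: f p; f q; s p; s q]
        | go [:: f p; f q; s q; s p] | go [:: f q; s q; f p; s p]
        | go [:: f q; f p; s q; s p] | go [:: f q; f p; s p; s q] ].
Qed.

End Pointers.

(** * Block swaps *)

(* The new position of the entry at position [t] of [0 :: w] when the blocks
   between the cuts [a, b] and [c, d] are swapped. *)
Definition shift (a b c d t : nat) : nat :=
  if t <= a then t else if t <= b then t + (d - b)
  else if t <= c then (t + d + a) - (b + c)
  else if t <= d then t - (c - a) else t.

(** The block [A] begins with the extra entry [0], so the cuts of the word itself are the partial
    sums of sizes minus one. *)
Lemma index_block_swap (A B C D E : seq nat) (x : nat) :
  let w := A ++ B ++ C ++ D ++ E in
  0 < size A -> uniq w -> x \in w ->
  index x (A ++ D ++ C ++ B ++ E) =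
  shift (size A).-1 (size A + size B).-1 (size A + size B + size C).-1
    (size A + size B + size C + size D).-1 (index x w).
Proof.
move=> w A0 Uw xw; move: Uw xw; rewrite /w /shift {w}.
have icat (s t : seq nat) : index x (s ++ t) =
    if x \in s then index x s else size s + index x t by apply: index_cat.
rewrite !cat_uniq !has_cat !negb_or !mem_cat !icat.
have mE (s : seq nat) : (x \in s) = (index x s < size s) by rewrite index_mem.
have dE (s t : seq nat) : ~~ has (mem s) t -> x \in t -> (x \in s) = false.
  by move=> /hasPn st /st /negbTE.
case/and3P=> _ /and4P[AB AC AD AE].
case/and3P=> _ /and3P[BC BD BE] /and3P[_ /andP[CD CE] /and3P[_ DE _]].
case/or4P=> [xA | xB | xC | /orP[xD|xE]].
- rewrite xA; move: xA; rewrite mE => lt_x; clear - A0 lt_x; do !case: ifP => ?; lia.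
- have xD : (x \in D) = false by apply: contraTF xB => /(dE _ _ BD) ->.
  have xC : (x \in C) = false by apply: contraTF xB => /(dE _ _ BC) ->.
  rewrite xC xD (dE _ _ AB) // xB; move: xB; rewrite mE => lt_x; clear - A0 lt_x;
    do !case: ifP => ?; lia.
- have xD : (x \in D) = false by apply: contraTF xC => /(dE _ _ CD) ->.
  rewrite xD (dE _ _ AC) // xC (dE _ _ BC) //; move: xC; rewrite mE => lt_x;
    clear - A0 lt_x; do !case: ifP => ?; lia.
- rewrite xD (dE _ _ AD) // (dE _ _ CD) // (dE _ _ BD) //; move: xD;
    rewrite mE => lt_x; clear - A0 lt_x; do !case: ifP => ?; lia.
rewrite (dE _ _ AE) // (dE _ _ BE) // (dE _ _ CE) // (dE _ _ DE) //; clear - A0;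
  do !case: ifP => ?; lia.
Qed.

(** The two parities give the three swapped blocks the vectors (1,0), (1,1), (0,1) of F_2^2, and
    (0,0) outside. The order of [t] and [u] flips when they lie in different swapped blocks, that
    is, when the determinant of their vectors is 1. *)
Lemma ltn_shift a b c d t u : a <= b -> b <= c -> c <= d ->
  (shift a b c d t < shift a b c d u) =
  (t < u) (+) ((a < t) (+) (c < t)) && ((b < u) (+) (d < u))
          (+) ((b < t) (+) (d < t)) && ((a < u) (+) (c < u)).
Proof.
move=> ab bc cd; rewrite /shift.
case: (leqP t a) => ta; [|case: (leqP t b) => tb; [|case: (leqP t c) => tc;
  [|case: (leqP t d) => td]]];
(case: (leqP u a) => ua; [|case: (leqP u b) => ub; [|case: (leqP u c) => uc;
  [|case: (leqP u d) => ud]]]).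
all: lia.
Qed.

(* [rp.*2.+1] and [lp.*2] order the two occurrences of a pointer [p] as in the
   pointer word: of two pointers at the same cut, the right one comes first. *)
Definition cuts_ordered (rp lp rq lq : nat) : bool :=
  [&& minn rp.*2.+1 lp.*2 < minn rq.*2.+1 lq.*2,
      minn rq.*2.+1 lq.*2 < maxn rp.*2.+1 lp.*2 &
      maxn rp.*2.+1 lp.*2 < maxn rq.*2.+1 lq.*2].

Definition move_shift (rp lp rq lq : nat) : nat -> nat :=
  shift (minn rp lp.-1) (minn rq lq.-1) (maxn rp lp.-1) (maxn rq lq.-1).

Section Splice.
Variables (rp lp rq lq : nat).
Hypotheses (lp0 : 0 < lp) (lq0 : 0 < lq) (o : cuts_ordered rp lp rq lq).
Local Notation sh := (move_shift rp lp rq lq).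

Lemma cuts_sorted :
  [/\ minn rp lp.-1 <= minn rq lq.-1, minn rq lq.-1 <= maxn rp lp.-1
    & maxn rp lp.-1 <= maxn rq lq.-1].
Proof. by case/and3P: o; split; lia. Qed.

Lemma move_shift_cases :
  [\/ [/\ rp < rq, rq < lp, lp < lq & sh = shift rp rq lp.-1 lq.-1],
      [/\ rp < lq, lq < lp, lp <= rq & sh = shift rp lq.-1 lp.-1 rq],
      [/\ lp <= rq, rq < rp, rp < lq & sh = shift lp.-1 rq rp lq.-1]
    | [/\ lp < lq, lq <= rp, rp < rq & sh = shift lp.-1 lq.-1 rp rq]].
Proof.
move: o; rewrite /cuts_ordered => /and3P[o1 o2 o3].
case: (leqP lp rp) => ?; case: (leqP lq rq) => ?;
  [constructor 4 | constructor 3 | constructor 2 | constructor 1];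
  split; try lia; by rewrite /move_shift; congr shift; lia.
Qed.

Local Ltac splice :=
  case: move_shift_cases => -[? ? ? ->]; clear o;
  destruct lp as [|lp'], lq as [|lq'] => //; simpl;
  rewrite /shift; do !case: ifP => ?; lia.

(** In view of [C_permE], [sh l = (sh r).+1] is a link of the new [C_perm] from the pointer with
    [lpos] equal to [l] to the one with [rpos] equal to [r]. Here [p] becomes fixed. *)
Lemma splice_p : sh lp = (sh rp).+1.
Proof. splice. Qed.

Lemma splice_q : sh lq = (sh rq).+1.
Proof. splice. Qed.

(** A link that avoids [p] and [q] survives; the next four lemmas shortcut a path through [p],
    through [q], or through both. *)
Lemma splice_away l r : l = r.+1 -> r != rp -> r != rq -> l != lp -> l != lq ->
  sh l = (sh r).+1.
Proof. move=> *; splice. Qed.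

Lemma splice_through_p l r : l = rp.+1 -> lp = r.+1 -> r != rp -> r != rq ->
  l != lp -> l != lq -> sh l = (sh r).+1.
Proof. move=> *; splice. Qed.

Lemma splice_through_q l r : l = rq.+1 -> lq = r.+1 -> r != rp -> r != rq ->
  l != lp -> l != lq -> sh l = (sh r).+1.
Proof. move=> *; splice. Qed.

Lemma splice_through_pq l r : l = rp.+1 -> lp = rq.+1 -> lq = r.+1 ->
  r != rp -> r != rq -> l != lp -> l != lq -> sh l = (sh r).+1.
Proof. move=> *; splice. Qed.

Lemma splice_through_qp l r : l = rq.+1 -> lq = rp.+1 -> lp = r.+1 ->
  r != rp -> r != rq -> l != lp -> l != lq -> sh l = (sh r).+1.
Proof. move=> *; splice. Qed.

End Splice.

(** * The effect of a move *)

Lemma cdsC p q w : cds p q w = cds q p w.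
Proof. by rewrite /cds ![minn (_ w p) _]minnC ![maxn (_ w p) _]maxnC. Qed.

Lemma compatibleC p q w : compatible w p q = compatible w q p.
Proof.
rewrite /compatible; have -> : [seq x <- pointer_word w | x \in [:: p; q]] =
  [seq x <- pointer_word w | x \in [:: q; p]].
  by apply: eq_filter => x; rewrite !inE orbC.
by rewrite !inE orbC.
Qed.

(* The parity of the number of occurrences of the pointer [p] before the entry at
   position [t]. *)
Definition inside (w : seq nat) (p t : nat) : bool :=
  (rpos w p < t) (+) (lpos w p <= t).

Section Move.
Variables (n : nat) (w : seq nat).
Hypothesis pw : perm_eq w (iota 1 n).

Lemma compatible_inside p r : is_pointer n p -> is_pointer n r -> r != p ->
  compatible w r p = inside w p (rpos w r) (+) inside w p (lpos w r).
Proof.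
move=> pp rp nrp; rewrite (compatibleE pw) /cross (word_size pw) rp pp nrp /=.
have /andP[_ /ltnW lep] := pp; have /andP[_ /ltnW ler] := rp.
have nr : rpos w r != rpos w p.
  by apply: contraNneq nrp => /(rpos_inj pw ler lep) ->.
rewrite /inside; clear - nr.
have -> : (rpos w r < rpos w p) = ~~ (rpos w p < rpos w r) by lia.
have -> : (rpos w r < lpos w p) = ~~ (lpos w p <= rpos w r) by lia.
have -> : (lpos w r <= rpos w p) = ~~ (rpos w p < lpos w r) by lia.
have -> : (lpos w r < lpos w p) = ~~ (lpos w p <= lpos w r) by lia.
by do 4!case: (_ <= _).
Qed.

Lemma compatible_ordered p q : compatible w p q ->
  cuts_ordered (rpos w p) (lpos w p) (rpos w q) (lpos w q) \/
  cuts_ordered (rpos w q) (lpos w q) (rpos w p) (lpos w p).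
Proof.
move=> cpq; have [pp qp npq] := compatible_pointer pw cpq.
have /andP[_ /ltnW lep] := pp; have /andP[_ /ltnW leq] := qp.
have nr : rpos w p != rpos w q.
  by apply: contraNneq npq => /(rpos_inj pw lep leq) ->.
have nl : lpos w p != lpos w q.
  by apply: contraNneq npq => /(lpos_inj pw lep leq) ->.
move: cpq; rewrite (compatibleE pw) /cross => /and4P[_ _ _].
set a := rpos w p; set b := lpos w p; set c := rpos w q; set d := lpos w q.
have -> : (a < c) (+) (a < d) (+) (b <= c) (+) (b < d) =
   (a.*2.+1 < c.*2.+1) (+) (a.*2.+1 < d.*2) (+) (b.*2 < c.*2.+1) (+) (b.*2 < d.*2).
  by congr (_ (+) _ (+) _ (+) _); lia.
rewrite interleave_addb;
  first by rewrite /cuts_ordered -!andbA => /orP[]/and3P[-> -> ->]; [left|right].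
all: by subst a b c d; clear - nr nl; lia.
Qed.

Section Ordered.
Variables p q : nat.
Hypotheses (cpq : compatible w p q)
  (o : cuts_ordered (rpos w p) (lpos w p) (rpos w q) (lpos w q)).
Let sh := move_shift (rpos w p) (lpos w p) (rpos w q) (lpos w q).

Lemma cds_rpos_ordered :
  perm_eq (cds p q w) w /\ (forall x, x <= n -> rpos (cds p q w) x = sh (rpos w x)).
Proof.
have [pp qp npq] := compatible_pointer pw cpq.
have /andP[p0 ltp] := pp; have /andP[q0 ltq] := qp.
have [s1 s2 s3] := cuts_sorted (lpos_gt0 w p) (lpos_gt0 w q) o.
have s4 : maxn (rpos w q) (lpos w q).-1 <= size w.
  rewrite (word_size pw) geq_max (rpos_le pw (ltnW ltq)) /=.
  by have := lpos_le pw (ltnW ltq); lia.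
rewrite /cds !(first_cutE pw) // !(second_cutE pw) // /sh /move_shift.
move: s1 s2 s3 s4.
set a := minn (rpos w p) _; set b := minn (rpos w q) _.
set c := maxn (rpos w p) _; set d := maxn (rpos w q) _.
clearbody a b c d => ab bc cd dn.
rewrite (minn_idPl ab) (maxn_idPr ab) (minn_idPl cd) (maxn_idPr cd).
have wE : w = take a w ++ drop a (take b w) ++ drop b (take c w) ++ drop c (take d w)
  ++ drop d w.
  rewrite -{1}(cat_take_drop d w) -{1}(cat_take_drop c (take d w)) take_takel //.
  rewrite -{1}(cat_take_drop b (take c w)) take_takel //.
  by rewrite -{1}(cat_take_drop a (take b w)) take_takel // -!catA.
have sA : size (take a w) = a by rewrite size_takel //; lia.
have sB : size (drop a (take b w)) = b - a by rewrite size_drop size_takel //; lia.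
have sC : size (drop b (take c w)) = c - b by rewrite size_drop size_takel //; lia.
have sD : size (drop c (take d w)) = d - c by rewrite size_drop size_takel //; lia.
move: wE sA sB sC sD.
set A := take a w; set B := drop a _; set C := drop b _; set D := drop c _;
  set E := drop d w.
move=> wE sA sB sC sD; split.
  rewrite [X in perm_eq _ X]wE; apply/seq.permP => f; rewrite !count_cat; clear; lia.
move=> x le_xn.
have Uw := word0_uniq pw; have xw : x \in 0 :: w by rewrite (word0_mem pw).
rewrite /rpos -!cat_cons index_block_swap.
- rewrite /= sA sB sC sD -wE; congr shift; clear - ab bc cd; lia.
- by [].
- by rewrite !cat_cons -wE.
- by rewrite !cat_cons -wE.
Qed.

Lemma cds_lpos_ordered x : x <= n -> lpos (cds p q w) x = sh (lpos w x).
Proof.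
move=> le_xn; have [pv rE] := cds_rpos_ordered.
have pv' := perm_trans pv pw.
have [/eqP->|ne] := boolP (x == n); last first.
  by have lt_xn : x < n; rewrite ?ltn_neqAle ?ne // (lposE pv') // (lposE pw) // rE.
(* For [x = n] the position [n + 1] lies beyond the last cut, so the shift fixes it. *)
have [_ qp _] := compatible_pointer pw cpq; have /andP[_ ltq] := qp.
have [s1 s2 s3] := cuts_sorted (lpos_gt0 w p) (lpos_gt0 w q) o.
have := rpos_le pw (ltnW ltq); have := rpos_le pw ltq; rewrite -(lposE pw) //.
rewrite (lpos_n pv') (lpos_n pw) /sh /move_shift /shift; clear - s1 s2 s3 => *.
do !case: ifP => ?; lia.
Qed.

Lemma C_perm_cds_ordered :
  [/\ C_perm (cds p q w) p = p, C_perm (cds p q w) q = q &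
   forall x, x <= n -> x != p -> x != q -> exists m,
   [/\ C_perm (cds p q w) x = iter m.+1 (C_perm w) x,
       C_perm (cds p q w) x \notin [:: p; q] &
       forall i, i < m -> iter i.+1 (C_perm w) x \in [:: p; q]]].
Proof.
have [pv rE] := cds_rpos_ordered; have lE := cds_lpos_ordered.
have pv' := perm_trans pv pw.
have [/andP[_ /ltnW lep] /andP[_ /ltnW leq] npq] := compatible_pointer pw cpq.
have lp0 := lpos_gt0 w p; have lq0 := lpos_gt0 w q.
have eqC x y : x <= n -> y <= n -> sh (lpos w x) = (sh (rpos w y)).+1 ->
    C_perm (cds p q w) x = y.
  by move=> lex ley e; apply/eqP; rewrite (C_permE pv') // lE // rE // e.
split; [by apply: eqC => //; apply: splice_p | by apply: eqC => //; apply: splice_q |].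
move=> x lex nxp nxq.
have nl z : z <= n -> x != z -> lpos w x != lpos w z.
  by move=> lez; apply: contraNneq => /(lpos_inj pw lex lez) ->.
have nr y z : y <= n -> z <= n -> y != z -> rpos w y != rpos w z.
  by move=> ley lez; apply: contraNneq => /(rpos_inj pw ley lez) ->.
have nC y z : y <= n -> z <= n -> y != z -> C_perm w y != C_perm w z.
  by move=> ley lez; apply: contraNneq => /(C_perm_inj pw ley lez) ->.
pose Cle := C_perm_le pw; pose Cl := C_perm_lpos pw.
(* The cases follow the path from [x] until it leaves [p] and [q]; by injectivity it meets each at
   most once, so [m] is at most 2. *)
have [e1|n1] := eqVneq (C_perm w x) p.
  have n2 : C_perm w p != p by rewrite -[X in _ != X]e1 nC // eq_sym.
  have [e2|n3] := eqVneq (C_perm w p) q.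
    have n4 : C_perm w q != p by rewrite -[X in _ != X]e1 nC // eq_sym.
    have n5 : C_perm w q != q by rewrite -[X in _ != X]e2 nC // eq_sym.
    have e : C_perm (cds p q w) x = C_perm w q.
      apply: eqC; rewrite ?Cle //; apply: splice_through_pq => //;
        rewrite ?nl ?nr ?Cle ?Cl ?e1 ?e2 //.
    exists 2; split; rewrite ?e /= ?e1 ?e2 ?inE ?negb_or ?n4 ?n5 //.
    by case=> [|[]] //= _; rewrite ?e1 ?e2 !inE eqxx ?orbT.
  have e : C_perm (cds p q w) x = C_perm w p.
    apply: eqC; rewrite ?Cle //; apply: splice_through_p => //;
      rewrite ?nl ?nr ?Cle ?Cl ?e1 //.
  exists 1; split; rewrite ?e /= ?e1 ?inE ?negb_or ?n2 ?n3 //.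
  by case=> [|[]] //= _; rewrite ?e1 !inE eqxx ?orbT.
have [e1|n2] := eqVneq (C_perm w x) q.
  have n3 : C_perm w q != q by rewrite -[X in _ != X]e1 nC // eq_sym.
  have [e2|n4] := eqVneq (C_perm w q) p.
    have n4 : C_perm w p != p by rewrite -[X in _ != X]e2 nC // eq_sym.
    have n5 : C_perm w p != q by rewrite -[X in _ != X]e1 nC // eq_sym.
    have e : C_perm (cds p q w) x = C_perm w p.
      apply: eqC; rewrite ?Cle //; apply: splice_through_qp => //;
        rewrite ?nl ?nr ?Cle ?Cl ?e1 ?e2 //.
    exists 2; split; rewrite ?e /= ?e1 ?e2 ?inE ?negb_or ?n4 ?n5 //.
    by case=> [|[]] //= _; rewrite ?e1 ?e2 !inE eqxx ?orbT.
  have e : C_perm (cds p q w) x = C_perm w q.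
    apply: eqC; rewrite ?Cle //; apply: splice_through_q => //;
      rewrite ?nl ?nr ?Cle ?Cl ?e1 //.
  exists 1; split; rewrite ?e /= ?e1 ?inE ?negb_or ?n4 ?n3 //.
  by case=> [|[]] //= _; rewrite ?e1 !inE eqxx ?orbT.
have e : C_perm (cds p q w) x = C_perm w x.
  apply: eqC; rewrite ?Cle //; apply: splice_away => //; rewrite ?nl ?nr ?Cle ?Cl //.
by exists 0; split; rewrite ?e ?inE ?negb_or ?n1.
Qed.

(** By [ltn_shift] each of the four comparisons in [cross] changes by a determinant of [inside]
    parities. These add up bilinearly, and the sum of [inside] over the two occurrences of a pointer
    is its compatibility, by [compatible_inside]. *)
Lemma compatible_cds_ordered r s : is_pointer n r -> is_pointer n s -> r != s ->
  r \notin [:: p; q] -> s \notin [:: p; q] ->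
  compatible (cds p q w) r s =
  compatible w r s (+) (compatible w r p && compatible w s q)
                   (+) (compatible w r q && compatible w s p).
Proof.
move=> rp sp nrs; rewrite !inE !negb_or => /andP[nrp nrq] /andP[nsp nsq].
have [pv rE] := cds_rpos_ordered; have lE := cds_lpos_ordered.
have pv' := perm_trans pv pw.
have [pp qp npq] := compatible_pointer pw cpq.
rewrite !(compatible_inside pp) // !(compatible_inside qp) //.
rewrite (compatibleE pv') (compatibleE pw) /cross (word_size pv') (word_size pw) rp sp
  nrs /=.
have /andP[_ /ltnW ler] := rp; have /andP[_ /ltnW les] := sp.
rewrite !rE // !lE // [_ (lpos w r) <= _]leqNgt [lpos w r <= _]leqNgt.
have [s1 s2 s3] := cuts_sorted (lpos_gt0 w p) (lpos_gt0 w q) o.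
have shE t u : (sh t < sh u) =
    (t < u) (+) inside w p t && inside w q u (+) inside w q t && inside w p u.
  have iE x : inside w x =1 fun t => (minn (rpos w x) (lpos w x).-1 < t) (+) (maxn
    (rpos w x) (lpos w x).-1 < t).
    move=> v; rewrite /inside; have := lpos_gt0 w x; clear => l0.
    have -> : (lpos w x <= v) = ((lpos w x).-1 < v) by lia.
    by rewrite /minn /maxn; case: ifP => // _; rewrite addbC.
  by rewrite !iE /sh /move_shift ltn_shift.
rewrite !shE.
move: (inside w p (rpos w r)) (inside w p (lpos w r)) (inside w p (rpos w s)) (inside
  w p (lpos w s)).
move: (inside w q (rpos w r)) (inside w q (lpos w r)) (inside w q (rpos w s)) (inside
  w q (lpos w s)).
move: (rpos w r < rpos w s) (rpos w r < lpos w s) (rpos w s < lpos w r) (lpos w r <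
  lpos w s).
by do 12!(move=> []; rewrite /=).
Qed.

End Ordered.

Lemma perm_cds p q : compatible w p q -> perm_eq (cds p q w) (iota 1 n).
Proof.
move=> cpq; apply: perm_trans pw.
case: (compatible_ordered cpq) => o; first by have [] := cds_rpos_ordered cpq o.
by rewrite cdsC; rewrite compatibleC in cpq; have [] := cds_rpos_ordered cpq o.
Qed.

(* The cycles of [C_perm (cds p q w)] are those of [C_perm w] with [p] and [q]
   deleted. *)
Lemma C_perm_cds p q : compatible w p q ->
  [/\ C_perm (cds p q w) p = p, C_perm (cds p q w) q = q &
   forall x, x <= n -> x != p -> x != q -> exists m,
   [/\ C_perm (cds p q w) x = iter m.+1 (C_perm w) x,
       C_perm (cds p q w) x \notin [:: p; q] &
       forall i, i < m -> iter i.+1 (C_perm w) x \in [:: p; q]]].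
Proof.
move=> cpq; case: (compatible_ordered cpq) => o; first exact: C_perm_cds_ordered.
rewrite cdsC; rewrite compatibleC in cpq; have [h1 h2 h3] := C_perm_cds_ordered cpq o.
split=> // x lex nxp nxq; have [m [e1 e2 e3]] := h3 x lex nxq nxp; exists m.
have mC y : (y \in [:: p; q]) = (y \in [:: q; p]) by rewrite !inE orbC.
by split=> // [|i]; rewrite mC //; apply: e3.
Qed.

(* The move acts on the overlap graph as the Schur complement over F_2 of the
   edge [p]-[q]. *)
Lemma compatible_cds p q r s : compatible w p q ->
  is_pointer n r -> is_pointer n s -> r != s ->
  r \notin [:: p; q] -> s \notin [:: p; q] ->
  compatible (cds p q w) r s =
  compatible w r s (+) (compatible w r p && compatible w s q)
                   (+) (compatible w r q && compatible w s p).
Proof.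
move=> cpq rp sp nrs nr ns.
case: (compatible_ordered cpq) => o; first exact: compatible_cds_ordered.
rewrite cdsC; rewrite compatibleC in cpq.
have mC y : (y \in [:: p; q]) = (y \in [:: q; p]) by rewrite !inE orbC.
by rewrite (compatible_cds_ordered cpq o) -?mC // -!addbA; congr addb; rewrite addbC.
Qed.

End Move.

(** * Single-cycle permutations *)

(** All moved points share the cycle of [0]. As [0] goes to [n], reading this cycle from [n] to [0]
    exhausts it, so that every moved point other than [0] and [n] lies in the strategic pile. *)
Definition single_cycle (n : nat) (w : seq nat) : Prop :=
  [/\ perm_eq w (iota 1 n), 0 < n, C_perm w 0 = n &
      forall x, x <= n -> C_perm w x = x \/ exists i, iter i (C_perm w) x = 0].

Definition live (n : nat) (w : seq nat) : {set 'I_n.+1} :=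
  [set x in pointers n | C_perm w x != x].

Lemma rpos_surj n w t : perm_eq w (iota 1 n) -> 0 < t <= n ->
  exists2 x, 0 < x <= n & rpos w x = t.
Proof.
move=> pw /andP[t0 tn]; have lt_t : t < size (0 :: w) by rewrite /= (word_size pw).
exists (nth 0 (0 :: w) t).
  rewrite -(word_mem pw); case: t t0 lt_t {tn} => //= t _.
  exact: mem_nth.
by rewrite /rpos index_uniq ?(word0_uniq pw).
Qed.

(** The two occurrences of a fixed pointer are at the same cut, hence separate nothing. *)
Lemma compatible_nonfixed n w p r : perm_eq w (iota 1 n) ->
  compatible w r p -> C_perm w p != p.
Proof.
move=> pw crp; have [rp pp nrp] := compatible_pointer pw crp.
have /andP[_ /ltnW lep] := pp.
apply: contraTneq crp => Cp; rewrite (compatible_inside pw) // /inside.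
by rewrite (C_perm_lpos pw lep) Cp !addbb.
Qed.

Section SingleCycle.
Variables (n : nat) (w : seq nat).
Hypothesis sw : single_cycle n w.

Lemma single_cycle_cds p q : compatible w p q -> single_cycle n (cds p q w).
Proof.
case: sw => pw n0 C0 reach cpq; have pv := perm_cds pw cpq.
have [pp qp npq] := compatible_pointer pw cpq.
have [Cp Cq Cx] := C_perm_cds pw cpq.
have /andP[p0 ltp] := pp; have /andP[q0 ltq] := qp.
split=> //.
  have [] := Cx 0; rewrite ?ltn_eqF // => -[|m] [e _ h]; first by rewrite e /= C0.
  have := h 0 (ltn0Sn _); rewrite /= C0 !inE; lia.
move=> x lex.
have [->|nxp] := eqVneq x p; first by left.
have [->|nxq] := eqVneq x q; first by left.
case: (reach x lex) => [Cxx | [i]].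
  left; have [m [e _ _]] := Cx x lex nxp nxq; rewrite e.
  by elim: m {e} => [|m IHm] //; rewrite iterS IHm.
(* Induction on the number of old steps to [0]: a new step makes [m + 1] of them, and cannot jump
   over [0] because it skips only [p] and [q]. *)
move=> ei; right; elim/ltn_ind: i x lex nxp nxq ei => i IH x lex nxp nxq ei.
have [m [e nin h]] := Cx x lex nxp nxq.
case: i ei IH => [|i] ei IH; first by exists 0.
have le_mi : m <= i.
  rewrite leqNgt; apply/negP => /h; rewrite ei !inE; lia.
have [|||||j ej] := IH (i - m) _ (C_perm (cds p q w) x).
- lia.
- exact: (C_perm_le pv).
- by move: nin; rewrite !inE negb_or => /andP[].
- by move: nin; rewrite !inE negb_or => /andP[].
- by rewrite e -iterD -[RHS]ei; congr iter; lia.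
by exists j.+1; rewrite iterSr.
Qed.

Lemma live_cds (p q : 'I_n.+1) : compatible w p q ->
  live n (cds p q w) = live n w :\: [set p; q].
Proof.
move=> cpq; have [pw n0 C0 reach] := sw.
have [pv _ _ reach'] := single_cycle_cds cpq.
have [Cp Cq Cx] := C_perm_cds pw cpq.
apply/setP => x; rewrite !inE negb_or.
have [->|nxp] := eqVneq x p; first by rewrite Cp eqxx andbF.
have [->|nxq] := eqVneq x q; first by rewrite Cq eqxx andbF.
rewrite /=; have [xp|] := boolP (is_pointer n x) => //=.
have lex : x <= n by rewrite -ltnS.
have [m [e nin h]] := Cx x lex nxp nxq; congr negb.
apply/eqP/eqP => [Cxx | Cxx].
  case: (reach x lex) => // -[i ei].
  (* If [x] is fixed by the new permutation, its old orbit consists of [x] and of skipped points,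
     all in [[:: p; q]]; it misses [0]. *)
  have st : forall j, exists k, iter j (C_perm w) x = iter k (C_perm w) x /\ k <= m.
    elim=> [|j [k [ej le_k]]]; first by exists 0.
    case: (ltnP k m) => [lt_k|ge_k]; first by exists k.+1; rewrite !iterS ej.
    have ek : k = m by lia.
    by exists 0; rewrite iterS ej ek -iterS -e Cxx.
  have [k [ek le_k]] := st i; rewrite ei in ek.
  case: k ek le_k => [|k] ek le_k; first by move: xp; rewrite /is_pointer;
    move: ek => /= <-.
  have := h k le_k; rewrite -ek !inE.
  have [/andP[p0 _] /andP[q0 _] _] := compatible_pointer pw cpq; lia.
by rewrite e; elim: m {e nin h} => [|m IHm] //; rewrite iterS IHm.
Qed.

Lemma live_pointer (p : 'I_n.+1) : p \in live n w -> is_pointer n p.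
Proof. by rewrite !inE => /andP[]. Qed.

Lemma compatible_live (p q : 'I_n.+1) : compatible w p q ->
  [/\ p \in live n w, q \in live n w & p != q].
Proof.
move=> cpq; have [pw _ _ _] := sw.
have [pp qp npq] := compatible_pointer pw cpq.
by rewrite !inE pp qp (compatible_nonfixed pw cpq) (@compatible_nonfixed n w p q) //
  compatibleC.
Qed.

Lemma compatible_ord p q : compatible w p q ->
  exists x y : 'I_n.+1, x = p :> nat /\ y = q :> nat.
Proof.
move=> cpq; have [pw _ _ _] := sw.
have [/andP[_ ltp] /andP[_ ltq] _] := compatible_pointer pw cpq.
by exists (@Ordinal n.+1 p (ltnW ltp)), (@Ordinal n.+1 q (ltnW ltq)).
Qed.

Lemma rpos_adjacent x : 0 < x < n -> C_perm w x = x -> rpos w x.+1 = (rpos w x).+1.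
Proof.
move=> /andP[_ ltx] Cx; have [pw _ _ _] := sw.
by rewrite -(lposE pw) // (C_perm_lpos pw (ltnW ltx)) Cx.
Qed.

Lemma rpos_wrap : rpos w 1 = (rpos w n).+1.
Proof.
have [pw n0 C0 _] := sw; rewrite -(lposE pw) //.
by rewrite (C_perm_lpos pw (leq0n n)) C0.
Qed.

(** If all pointers were fixed, the entries 1 to [n] would stand consecutively, with [n] no earlier
    than 1; but [C_perm w 0 = n] puts 1 just after [n]. *)
Lemma live_neq0 : live n w != set0.
Proof.
have [pw n0 C0 _] := sw; apply/negP => /eqP l0.
have h x : x < n -> rpos w x.+1 = rpos w 1 + x.
  elim: x => [|x IHx] ltx; first by rewrite addn0.
  rewrite rpos_adjacent // ?IHx ?addnS //; first exact: ltnW.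
  have /setP/(_ (@Ordinal n.+1 x.+1 (ltnW ltx))) := l0;
    rewrite !inE /is_pointer /= ltx /=.
  by move/negbFE/eqP.
have := h n.-1; rewrite prednK // leqnn => /(_ isT).
rewrite rpos_wrap; lia.
Qed.

(** The only nontrivial cycle sends [n] to [a], [a] to [0] and [0] to [n]. So [a + 1] comes first, 1
    follows [n], and every other entry follows its predecessor. *)
Lemma live1_sigma (a : 'I_n.+1) : live n w = [set a] -> w = sigma n a.
Proof.
move=> la; have [pw n0 C0 _] := sw.
have al : a \in live n w by rewrite la set11.
have /andP[a0 ltan] := live_pointer al.
have fx x : x <= n -> C_perm w x <> x -> x \in [:: 0; n; a : nat].
  move=> lex /eqP nC; have /setP/(_ (@Ordinal n.+1 x lex)) := la.
  rewrite !inE /is_pointer -val_eqE /= nC; lia.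
have Ca : C_perm w a != a by move: al; rewrite !inE => /andP[].
have nC0 : C_perm w n != n.
  by apply/eqP => /esym; rewrite -{1}C0 => /(C_perm_inj pw (leq0n n) (leqnn n)); lia.
have CCn x : x <= n -> C_perm w x != x -> C_perm w (C_perm w x) <> C_perm w x.
  by move=> lex /eqP nC e; apply: nC; apply: (C_perm_inj pw) e => //;
    apply: C_perm_le pw _ _.
have leC := C_perm_le pw.
have Ca0 : C_perm w a = 0.
  have := fx _ (leC a (ltnW ltan)) (CCn a (ltnW ltan) Ca).
  rewrite !inE => /or3P[/eqP-> // | /eqP e | /eqP e]; last by rewrite e eqxx in Ca.
  by have /(C_perm_inj pw (ltnW ltan) (leq0n n)) := etrans e (esym C0); lia.
have adj x : 0 < x < n -> x != a -> rpos w x.+1 = (rpos w x).+1.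
  move=> xn xa; apply: rpos_adjacent => //; apply/eqP; apply: contraT => /eqP nC.
  have /andP[_ /ltnW lex] := xn; have := fx x lex nC; rewrite !inE; lia.
have r1 : rpos w a.+1 = 1.
  by rewrite -(lposE pw) // (C_perm_lpos pw (ltnW ltan)) Ca0.
have rhi i : i < n - a -> rpos w (a.+1 + i) = i.+1.
  elim: i => [|i IHi] lti; first by rewrite addn0.
  by rewrite addnS adj ?IHi; lia.
have rn : rpos w n = n - a.
  have := rhi (n - a).-1; have -> : a.+1 + (n - a).-1 = n by lia.
  lia.
have rlo i : i < a -> rpos w i.+1 = n - a + i.+1.
  elim: i => [|i IHi] lti; first by rewrite rpos_wrap rn addn1.
  by rewrite adj ?IHi; lia.
have nthr x : 0 < x <= n -> nth 0 w (rpos w x).-1 = x.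
  move=> /andP[x0 lex]; have xw : x \in w by rewrite (word_mem pw) x0.
  by rewrite /rpos /= ltn_eqF //= nth_index.
apply: (@eq_from_nth _ 0) => [|i].
  by rewrite size_cat !size_iota (word_size pw); lia.
rewrite (word_size pw) nth_cat size_iota => lti; case: ltnP => [lt_i | ge_i].
  rewrite nth_iota // -[RHS]nthr ?rhi //; lia.
have lt_a : i - (n - a) < a by lia.
rewrite nth_iota // add1n -[RHS]nthr ?rlo //; last lia.
by congr nth; lia.
Qed.

Section Pointer.
Variable p : 'I_n.+1.
Hypothesis pl : p \in live n w.
Let f x := inside w p (rpos w x).

Lemma inside_step r : is_pointer n r -> r != p -> compatible w r p = f r (+) f r.+1.
Proof.
move=> rp nrp; have [pw _ _ _] := sw; have /andP[_ ltr] := rp.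
by rewrite (compatible_inside pw (live_pointer pl)) // (lposE pw).
Qed.

Lemma inside_self : f p.+1 = f p.
Proof.
have [pw _ _ _] := sw; have /andP[_ ltp] := live_pointer pl.
rewrite /f -(lposE pw) // /inside ltnn leqnn addbT /=; lia.
Qed.

(** The entry 1 comes right after [n], and an occurrence of [p] at the cut between them would force
    [p] to be [n] or [0]. *)
Lemma inside_wrap : f n = f 1.
Proof.
have [pw n0 C0 _] := sw; have /andP[p0 ltp] := live_pointer pl.
rewrite /f rpos_wrap /inside.
have n1 : rpos w p != rpos w n.
  by apply/eqP => /(rpos_inj pw (ltnW ltp) (leqnn n)); lia.
have n2 : lpos w p != (rpos w n).+1.
  rewrite -rpos_wrap -(lposE pw) //.
  by apply/eqP => /(lpos_inj pw (ltnW ltp) (leq0n n)); lia.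
by congr addb; lia.
Qed.

(** Without neighbours, [f] is constant on the entries. This confines [p] to one configuration, in
    which the cycle of [0] contains only [0], [n] and [p]. *)
Lemma isolated_live : (forall r : 'I_n.+1, r \in live n w -> ~~ compatible w r p) ->
  live n w = [set p].
Proof.
move=> iso; have [pw n0 C0 reach] := sw.
have pp := live_pointer pl; have /andP[p0 ltp] := pp.
have Cp : C_perm w p != p by move: pl; rewrite !inE => /andP[].
have fS r : 0 < r < n -> f r.+1 = f r.
  move=> rn; have [->|nrp] := eqVneq r p; first exact: inside_self.
  have /andP[_ ltr] := rn.
  have : ~~ compatible w r p.
    apply/negP => crp; have /= := iso (@Ordinal n.+1 r (ltnW ltr)).
    by rewrite crp;
      case/compatible_live: (crp : compatible w (@Ordinal n.+1 r (ltnW ltr)) p) => ->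
      _ _ /(_ isT).
  by rewrite inside_step //; do 2!case: f.
have fc x : 0 < x <= n -> f x = f 1.
  elim: x => [|[|x] IHx] // /andP[_ ltx]; rewrite fS //; apply: IHx; lia.
have fp : f p = (lpos w p <= rpos w p) by rewrite /f /inside ltnn.
have lp0 := lpos_gt0 w p; have rp0 := rpos_gt0 w p0.
have rpn := rpos_le pw (ltnW ltp).
have lpn := rpos_le pw ltp; rewrite -(lposE pw) // in lpn.
have fE x : 0 < x <= n -> (rpos w p < rpos w x) (+) (lpos w p <= rpos w x) = (lpos w p
  <= rpos w p).
  by move=> xn; rewrite -fp (fc p) ?p0 ?(ltnW ltp) // -(fc x).
(* If [rpos w p] is the smaller one, no entry lies between the two cuts, which makes [p] fixed.
   Otherwise every entry lies between them, so they are at the two ends of the word. *)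
case: (leqP (lpos w p) (rpos w p)) fE => [le_lr | lt_rl] fE; last first.
  have [|x xn rx] := @rpos_surj n w (rpos w p).+1 pw; first by lia.
  have := fE x xn; rewrite rx ltnSn /= => /negbFE le_lr.
  have /eqP : lpos w p = (rpos w p).+1 by lia.
  by rewrite -(C_permE pw) ?(ltnW ltp) // (negbTE Cp).
have rpE : rpos w p = n.
  apply/eqP; rewrite eqn_leq rpn leqNgt; apply/negP => lt_n.
  have [|x xn rx] := @rpos_surj n w (rpos w p).+1 pw; first by lia.
  by have := fE x xn; rewrite rx ltnSn /= (leq_trans le_lr).
have lpE : lpos w p = 1.
  apply/eqP; rewrite eqn_leq lp0 andbT leqNgt; apply/negP => lt_1.
  have [|x xn rx] := @rpos_surj n w (lpos w p).-1 pw; first by lia.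
  by have := fE x xn; rewrite rx; lia.
have Cn : C_perm w n = p.
  by apply/eqP; rewrite (C_permE pw) ?(ltnW ltp) // (lpos_n pw) rpE.
have Cp0 : C_perm w p = 0.
  by apply/eqP; rewrite (C_permE pw) ?(ltnW ltp) // lpE.
have key i x : x <= n -> iter i (C_perm w) x = 0 -> x \in [:: 0; n; p : nat].
  elim: i x => [|i IHi] x lex; first by move=> /= ->; rewrite inE.
  rewrite iterSr => /IHi; rewrite (C_perm_le pw lex) => /(_ isT).
  rewrite !inE => /or3P[] /eqP e.
  - by rewrite (C_perm_inj pw lex (ltnW ltp)) ?eqxx ?orbT // e Cp0.
  - by rewrite (C_perm_inj pw lex (leq0n n)) ?eqxx // e C0.
  - by rewrite (C_perm_inj pw lex (leqnn n)) ?eqxx ?orbT // e Cn.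
apply/setP => x; rewrite in_set1; apply/idP/eqP => [xl | -> //].
have /andP[x0 ltx] := live_pointer xl.
have nCx : C_perm w x != x by move: xl; rewrite !inE => /andP[].
case: (reach x (ltnW ltx)) => [/eqP|[i /(key _ _ (ltnW ltx))]];
  first by rewrite (negbTE nCx).
by rewrite !inE => ?; apply: ord_inj; lia.
Qed.

(* The degree of [p] is even: along [1, ..., n] the predicate [inside] flips
   exactly at the neighbours of [p], and it agrees at [n] and [1]. *)
Lemma degree_neq1 (q : 'I_n.+1) : compatible w q p ->
  exists2 r : 'I_n.+1, r != q & compatible w r p.
Proof.
move=> cqp; have [pw n0 C0 _] := sw.
have [qp pp nqp] := compatible_pointer pw cqp; have /andP[q0 ltq] := qp.
have [/existsP[r /andP[]] | /existsPn no] :=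
  boolP [exists r : 'I_n.+1, (r != q) && compatible w r p]; first by exists r.
have fS r : 0 < r < n -> f r.+1 = f r (+) (r == q).
  move=> rn; have [->|nrp] := eqVneq r p.
    by rewrite inside_self eq_sym (negbTE nqp) addbF.
  have /andP[_ ltr] := rn; have := inside_step rn nrp.
  have [->|nrq] := eqVneq r q; first by rewrite cqp; do 2!case: f.
  have := no (@Ordinal n.+1 r (ltnW ltr)); rewrite -val_eqE /= nrq /= => /negbTE ->.
  by do 2!case: f.
(* With [q] as only neighbour, [f] would flip just once between 1 and [n], against [inside_wrap]. *)
have fE x : 0 < x <= n -> f x = f 1 (+) (q < x).
  elim: x => [|[|x] IHx] // /andP[_ ltx]; first by rewrite ltnNge q0 addbF.
  rewrite fS // IHx; last by lia.
  by rewrite -addbA; congr addb; clear; lia.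
by have := fE n; rewrite n0 leqnn inside_wrap ltq => /(_ isT); case: f.
Qed.

End Pointer.
End SingleCycle.

(** * Cliques of twins and the game *)

(** Goodness in a form that persists along a play: [single_cycle] stands for condition (3), and the
    rest refers to live pointers. *)
Definition twin_clique (n : nat) (w : seq nat) (P : {set 'I_n.+1}) : Prop :=
  [/\ single_cycle n w, P \subset live n w,
      forall x y : 'I_n.+1, x \in P -> y \in P -> x != y -> compatible w x y &
      forall x y r : 'I_n.+1, x \in P -> y \in P -> r \in live n w ->
        r != x -> r != y -> compatible w r x = compatible w r y].

(** The move is arbitrary. In the Schur complement formula, twins [x] and [y] relate equally to [p]
    and to [q]: the two corrections to the pair [x, y] cancel, and those to [r, x] and to [r, y]
    agree. *)
Lemma twin_clique_cds n w (P : {set 'I_n.+1}) (p q : 'I_n.+1) :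
  twin_clique w P -> compatible w p q ->
  twin_clique (cds p q w) (P :\: [set p; q]).
Proof.
move=> [sw Pl cl tw] cpq; have [pw _ _ _] := sw.
have [pl ql npq] := compatible_live sw cpq.
have nin (x : 'I_n.+1) : x != p -> x != q -> val x \notin [:: val p; val q].
  by rewrite !inE negb_or !val_eqE => -> ->.
split; first exact: single_cycle_cds.
- by rewrite (live_cds sw) // setSD.
- move=> x y; rewrite !inE !negb_or => /andP[/andP[nxp nxq] xP] /andP[/andP[nyp nyq]
    yP] nxy.
  have xl := subsetP Pl x xP; have yl := subsetP Pl y yP.
  rewrite (compatible_cds pw cpq) ?(live_pointer xl) ?(live_pointer yl) ?nin //.
  rewrite (cl x y) // ![compatible w x _]compatibleC ![compatible w y _]compatibleC.
  rewrite (tw y x p) ?(tw y x q) 1?eq_sym // andbC.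
  by case: andb.
move=> x y r; rewrite (live_cds sw) // !inE !negb_or.
move=> /andP[/andP[nxp nxq] xP] /andP[/andP[nyp nyq] yP] /andP[/andP[nrp nrq] rp] nrx
  nry.
have xl := subsetP Pl x xP; have yl := subsetP Pl y yP.
have rl : r \in live n w by rewrite !inE.
rewrite !(compatible_cds pw cpq) ?(live_pointer xl) ?(live_pointer yl) ?(live_pointer
  rl) ?nin //.
rewrite (tw x y r) // ![compatible w x _]compatibleC ![compatible w y _]compatibleC.
by rewrite (tw y x p) ?(tw y x q) // eq_sym.
Qed.

(* Deleting pairs of [P] does not affect the rest of the graph, so if [P] had no
   neighbour it could be shrunk to an isolated pointer or to a component K_2. *)
Lemma twin_clique_connected n w (P : {set 'I_n.+1}) :
  twin_clique w P -> P != set0 -> P != live n w ->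
  exists2 p : 'I_n.+1, p \in P & exists2 q : 'I_n.+1, q \in live n w :\: P &
    compatible w p q.
Proof.
move=> tcP nP0 nPl.
have [/existsP[p /existsP[q /and3P[pP qlP cpq]]] | no] :=
  boolP [exists p : 'I_n.+1, exists q : 'I_n.+1, [&& p \in P, q \in live n w :\: P &
    compatible w p q]].
  by exists p => //; exists q.
have {}no (p q : 'I_n.+1) : p \in P -> q \in live n w -> q \notin P -> compatible w p
  q = false.
  move=> pP ql qP; apply/negbTE/negP => cpq; case/negP: no.
  by apply/existsP; exists p; apply/existsP; exists q; rewrite pP inE qP ql.
exfalso; have [m] := ubnP #|P|.
elim: m w P tcP nP0 nPl no => // m IHm w P tcP nP0 nPl no leP.
have [sw Pl cl tw] := tcP; have [pw _ _ _] := sw.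
have [p pP] := set0Pn _ nP0; have pl := subsetP Pl p pP.
(* A singleton [P] without outside neighbours is an isolated pointer, hence all of [live n w]. *)
have [P1 | [q]] := set_0Vmem (P :\ p).
  have PE : P = [set p].
    by apply/eqP; rewrite eqEsubset sub1set pP andbT -setD_eq0 P1.
  move: nPl; rewrite (isolated_live sw pl) ?PE ?eqxx // => r rl.
  have [->|nrp] := eqVneq r p.
    by apply/negP => /(compatible_live sw)[_ _]; rewrite eqxx.
  by rewrite compatibleC no // PE inE.
rewrite !inE => /andP[nqp qP].
have cqp := cl q p qP pP nqp; have ql := subsetP Pl q qP.
have cpq := cqp; rewrite compatibleC in cpq.
(* If [P] is just [p] and [q], then [p] has degree 1, which parity excludes. *)
have [P2|[r]] := set_0Vmem (P :\: [set p; q]).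
  have [r nrq crp] := degree_neq1 sw pl cqp.
  have [rl _ nrp] := compatible_live sw crp.
  have rP : r \notin P.
    by apply: contraFN (in_set0 r) => rP; rewrite -P2 !inE negb_or nrp nrq.
  by move: crp; rewrite compatibleC no.
move=> rP'; have lE := live_cds sw cpq.
apply: (IHm (cds p q w) (P :\: [set p; q])).
- exact: twin_clique_cds.
- by apply/set0Pn; exists r.
- apply: contra nPl; rewrite lE => /eqP e; rewrite eqEsubset Pl /=.
  apply/subsetP => x xl; have [xpq | nxpq] := boolP (x \in [set p; q]).
    by move: xpq; rewrite !inE => /orP[]/eqP->.
  have : x \in live n w :\: [set p; q] by rewrite in_setD nxpq xl.
  by rewrite -e in_setD => /andP[].
- move=> x y; rewrite lE !inE !negb_or => /andP[/andP[nxp nxq] xP] /andP[/andP[nyp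
    nyq] yl].
  rewrite nyp nyq /= => yP; have xl := subsetP Pl x xP.
  have yl' : y \in live n w by rewrite !inE.
  have nxy : x != y by apply: contraNneq yP => <-.
  rewrite (compatible_cds pw cpq) ?(live_pointer xl) ?(live_pointer yl') // ?inE
    ?negb_or ?val_eqE ?nxp ?nxq ?nyp ?nyq //.
  (* Both corrections vanish, as [y] is adjacent to neither [p] nor [q]. *)
  have nyP z : z \in P -> compatible w y z = false by move=> zP; rewrite compatibleC no.
  by rewrite compatibleC !nyP // !andbF.
apply: (@leq_trans #|P|); last exact: leP.
apply: proper_card; rewrite properE subsetDl /=; apply/subsetPn; exists p => //.
by rewrite !inE eqxx.
Qed.

(** * Strategies from an invariant *)

Section Strategy.
Variables (w0 : seq nat) (win ahead : seq nat -> Prop).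

Definition safe_after_ONE (w : seq nat) : Prop :=
  (cds_fixed_point w -> win w) /\
  forall p q, compatible w p q -> ahead (cds p q w).

Hypothesis ahead_win : forall w, ahead w -> cds_fixed_point w -> win w.
Hypothesis ahead_move : forall w, ahead w -> ~ cds_fixed_point w ->
  exists m : nat * nat, compatible w m.1 m.2 /\ safe_after_ONE (cds m.1 m.2 w).
Hypothesis ahead_w0 : ahead w0.

(** Classical choice of a good move from the current position alone; [(0, 0)] only shows that the
    type of moves is inhabited. *)
Definition move_for (w : seq nat) : nat * nat :=
  epsilon (inhabits (0, 0))
    (fun m : nat * nat => compatible w m.1 m.2 /\ safe_after_ONE (cds m.1 m.2 w)).

Lemma move_forP w : ahead w -> ~ cds_fixed_point w ->
  compatible w (move_for w).1 (move_for w).2 /\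
  safe_after_ONE (cds (move_for w).1 (move_for w).2 w).
Proof. by move=> aw_ nf;
  exact: (epsilon_spec (inhabits (0, 0)) _ (ahead_move aw_ nf)). Qed.

Lemma legal_rcons w h m :
  legal w (rcons h m) = legal w h && compatible (position w h) m.1 m.2.
Proof. by elim: h w => [|m' h IHh] w /=; rewrite ?andbT // IHh andbA. Qed.

Lemma strategy_invariant h : legal w0 h ->
  follows (fun h => move_for (position w0 h)) h ->
  if odd (size h) then safe_after_ONE (position w0 h) else ahead (position w0 h).
Proof.
elim/last_ind: h => [|h m IHh] //; rewrite legal_rcons => /andP[lh cm] fh.
have /IHh{IHh} : follows (fun h => move_for (position w0 h)) h.
  move=> i lti ei; have := fh i; rewrite size_rcons => /(_ (ltnW lti) ei).
  by rewrite nth_rcons lti -cats1 take_cat lti.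
have -> : position w0 (rcons h m) = cds m.1 m.2 (position w0 h).
  by rewrite /position foldl_rcons.
rewrite size_rcons /=; case: ifP => [_ /(_ lh) [_ ah] | eh /(_ lh) Sh] /=;
  first exact: ah.
(* Here the last move is ONE's, so [follows] identifies it with the chosen one. *)
have := fh (size h); rewrite size_rcons eh ltnSn => /(_ isT isT).
rewrite nth_rcons ltnn eqxx -cats1 take_size_cat // => ->.
have nf : ~ cds_fixed_point (position w0 h) by move=> /(_ m.1 m.2); rewrite cm.
by case: (move_forP Sh nf).
Qed.

Lemma strategy_wins h : legal w0 h ->
  follows (fun h => move_for (position w0 h)) h ->
  (cds_fixed_point (position w0 h) -> win (position w0 h)) /\
  (~ cds_fixed_point (position w0 h) -> ~~ odd (size h) ->
   compatible (position w0 h) (move_for (position w0 h)).1 (move_for (position w0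
     h)).2).
Proof.
move=> lh fh; have := strategy_invariant lh fh; case: ifP => [_ [fw _] | _ Sh];
  first by split.
by split=> [|nf _]; [apply: ahead_win | case: (move_forP Sh nf)].
Qed.

End Strategy.

(** * The invariant that ONE maintains *)

Section Game.
Variables (n : nat) (A : {set 'I_n.+1}).

Definition ONE_wins_at (w : seq nat) : Prop :=
  exists2 a : 'I_n.+1, a \in A & w = sigma n a.

(** The numerical hypotheses of the theorem, with the live pointers as strategic pile and the number
    of those outside [P] as [c]. *)
Definition ONE_ahead (w : seq nat) : Prop :=
  exists P : {set 'I_n.+1},
  [/\ twin_clique w P, 3 * #|live n w :\: P| < #|P| &
      #|live n w| %/ 2 + 1 + 2 * #|live n w :\: P| <= #|A :&: live n w|].

Lemma fixed_twin_clique w (P : {set 'I_n.+1}) : twin_clique w P -> cds_fixed_point w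
  -> #|P| <= 1.
Proof.
move=> [_ _ cl _] fw; rewrite leqNgt; apply/negP => /card_gt1P[x [y [xP yP nxy]]].
by have := fw x y; rewrite cl.
Qed.

Lemma single_live_win w : single_cycle n w -> #|live n w| <= 1 ->
  live n w \subset A -> ONE_wins_at w.
Proof.
move=> sw l1 lA; have l0 := live_neq0 sw; rewrite -card_gt0 in l0.
have /eqP/cards1P[a la] : #|live n w| = 1 by lia.
exists a; last exact: live1_sigma.
by apply: (subsetP lA); rewrite la set11.
Qed.

Lemma ONE_ahead_win w : ONE_ahead w -> cds_fixed_point w -> ONE_wins_at w.
Proof.
move=> [P [tc ltP leA]] fw; have [sw Pl _ _] := tc.
have P1 := fixed_twin_clique tc fw.
have := cardsD (live n w) P; rewrite (setIidPr Pl) => cD.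
(* Since [#|P| <= 1], the bound [3 * #|live n w :\: P| < #|P|] leaves no live pointer outside
   [P]. *)
have l1 : #|live n w| <= 1 by lia.
apply: single_live_win => //.
have l0 := live_neq0 sw; rewrite -card_gt0 in l0.
by apply/setIidPr/eqP; rewrite eqEcard subsetIr; lia.
Qed.

Lemma card_live_cds w (x y : 'I_n.+1) : single_cycle n w -> compatible w x y ->
  #|live n w| = #|live n (cds x y w)|.+2.
Proof.
move=> sw cxy; have [xl yl nxy] := compatible_live sw cxy.
rewrite (live_cds sw) // cardsD (_ : _ :&: _ = [set x; y]).
  rewrite cards2 nxy -addn2 subnK //; apply/card_gt1P; by exists x, y.
by apply/setP => z; rewrite in_setI in_set2 andbC; case: eqVneq => [->|_];
  rewrite ?xl //; case: eqVneq => [->|].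
Qed.

Lemma leq_card_setD2 (T : finType) (B : {set T}) (x y : T) :
  #|B| <= #|B :\: [set x; y]|.+2.
Proof.
have := cardsD B [set x; y]; have := subset_leq_card (subsetIr B [set x; y]).
rewrite cards2; case: (x != y) => /=; lia.
Qed.

(* As long as [P] is not everything, ONE only deletes one pointer outside [P],
   whatever TWO answers: this gains 2 on the required number of pointers of [A]
   and costs at most 3 pointers of [P]. *)
Lemma ONE_move_outside w (P : {set 'I_n.+1}) (p q : 'I_n.+1) :
  twin_clique w P -> 3 * #|live n w :\: P| < #|P| ->
  #|live n w| %/ 2 + 1 + 2 * #|live n w :\: P| <= #|A :&: live n w| ->
  p \in P -> q \in live n w :\: P -> compatible w p q ->
  safe_after_ONE ONE_wins_at ONE_ahead (cds p q w).
Proof.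
move=> tc ltP leA pP qD cpq; have [sw Pl _ _] := tc.
have tc' := twin_clique_cds tc cpq; have [sw' Pl' _ _] := tc'.
have cl := card_live_cds sw cpq.
have lE := live_cds sw cpq.
have P'E : P :\: [set p; q] = P :\ p.
  apply/setP => x; rewrite !inE negb_or; have [->|] := eqVneq x q;
    last by rewrite andbT.
  by move: qD; rewrite inE => /andP[/negbTE-> _]; rewrite !andbF.
have cP' : #|P| = #|P :\: [set p; q]|.+1 by rewrite P'E (cardsD1 p) pP.
have cD' : #|live n w :\: P| = #|live n (cds p q w) :\: (P :\: [set p; q])|.+1.
  have := cardsD (live n w) P; rewrite (setIidPr Pl).
  have := cardsD (live n (cds p q w)) (P :\: [set p; q]); rewrite (setIidPr Pl').
  have := subset_leq_card Pl; have := subset_leq_card Pl'; lia.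
(* As [q] is outside [P], there are at least 4 pointers in [P]; 3 of them survive, and this is no
   fixed point. *)
split=> [fw | x0 y0 cxy0]; first by have := fixed_twin_clique tc' fw; lia.
have [x [y [ex ey]]] := compatible_ord sw' cxy0; subst x0 y0.
have tc2 := twin_clique_cds tc' cxy0; have [sw2 Pl2 _ _] := tc2.
have cl2 := card_live_cds sw' cxy0; have lE2 := live_cds sw' cxy0.
have cA : #|A :&: live n w| <= #|A :&: live n (cds x y (cds p q w))|.+4.
  rewrite lE2 lE !setIDA; apply: leq_trans (leq_card_setD2 _ p q) _.
  by rewrite 2!ltnS leq_card_setD2.
have cP2 : #|P :\: [set p; q]| <= #|P :\: [set p; q] :\: [set x; y]|.+2.
  exact: leq_card_setD2.
have cD2 : #|live n (cds x y (cds p q w)) :\: (P :\: [set p; q] :\: [set x; y])| <=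
           #|live n (cds p q w) :\: (P :\: [set p; q])|.
  apply: subset_leq_card; rewrite lE2; apply/subsetP => z.
  rewrite !in_setD => /andP[nz /andP[nzxy ->]]; rewrite andbT.
  by move: nz; rewrite nzxy.
(* Over the round, [A] loses at most 4 live pointers while its threshold drops by at least 4: 2 from
   the halved term and 2 from the deletion of [q]. *)
exists ((P :\: [set p; q]) :\: [set x; y]); split => //;
  clear - cA cP2 cD2 cl cl2 cP' cD' ltP leA; lia.
Qed.

(** ONE's choice: an element of [B] if there is one, else any element of [L]; the truncated
    predecessor covers both cases. *)
Lemma setD1_card_pred (T : finType) (L B : {set T}) : B \subset L -> L != set0 ->
  exists2 x, x \in L & #|B :\ x| = #|B|.-1.
Proof.
move=> BL /set0Pn[z zL]; have [B0 | [x xB]] := set_0Vmem B.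
  by exists z => //; rewrite B0 set0D cards0.
by exists x; rewrite ?(subsetP BL) // [#|B|](cardsD1 x) xB.
Qed.

Lemma ONE_move_clique w : twin_clique w (live n w) ->
  #|live n w| %/ 2 + 1 <= #|A :&: live n w| -> 1 < #|live n w| ->
  exists x y : 'I_n.+1, compatible w x y /\ safe_after_ONE ONE_wins_at ONE_ahead (cds
    x y w).
Proof.
move=> tc leA l1; have [sw _ cl _] := tc.
have BL : live n w :\: A \subset live n w by apply: subsetDl.
have [|x xl Bx] := setD1_card_pred BL; first by rewrite -card_gt0 ltnW.
have [||y yl By] := @setD1_card_pred _ (live n w :\ x) (live n w :\: A :\ x).
- exact: setSD.
- by rewrite -card_gt0; have := cardsD1 x (live n w); rewrite xl; lia.
move: yl; rewrite in_setD1 => /andP[nyx yl].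
have cxy : compatible w x y by rewrite cl // eq_sym.
exists x, y; split=> //.
have tc' := twin_clique_cds tc cxy; have lE := live_cds sw cxy.
have k2 := card_live_cds sw cxy; rewrite -lE in tc'; have [sw' _ _ _] := tc'.
have B'E : #|live n (cds x y w) :\: A| = #|live n w :\: A|.-2.
  have -> : live n (cds x y w) :\: A = live n w :\: A :\ x :\ y.
    apply/setP => z; rewrite lE !in_setD in_set2 !in_set1.
    by case: (z \in A); case: (z == x); case: (z == y).
  by rewrite By Bx.
have cB v : #|A :&: live n v| + #|live n v :\: A| = #|live n v|.
  by rewrite setIC cardsID.
have cBw := cB w.
split=> [fw | x0 y0 cxy0].
  have l1' := fixed_twin_clique tc' fw.
  apply: single_live_win => //; rewrite -setD_eq0 -cards_eq0 B'E.
  (* At most 3 pointers were live, hence at most one was outside [A], and ONE has deleted it. *)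
  clear - leA l1 k2 l1' cBw; lia.
have [x' [y' [ex ey]]] := compatible_ord sw' cxy0; subst x0 y0.
have tc2 := twin_clique_cds tc' cxy0; have lE2 := live_cds sw' cxy0.
have k4 := card_live_cds sw' cxy0; rewrite -lE2 in tc2; have [sw2 _ _ _] := tc2.
have l0 := live_neq0 sw2; rewrite -card_gt0 in l0.
exists (live n (cds x' y' (cds x y w))); rewrite setDv cards0 muln0 addn0; split => //.
have cB2 := cB (cds x' y' (cds x y w)).
have : #|live n (cds x' y' (cds x y w)) :\: A| <= #|live n w :\: A|.-2.
  by rewrite -B'E; apply: subset_leq_card; rewrite lE2 setSD // subsetDl.
(* If ONE ran out of pointers outside [A], all live ones are in [A], and the threshold holds because
   at least one is left. *)
clear - leA l1 k2 k4 l0 cBw cB2; lia.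
Qed.

Lemma ONE_ahead_move w : ONE_ahead w -> ~ cds_fixed_point w ->
  exists m : nat * nat, compatible w m.1 m.2 /\
    safe_after_ONE ONE_wins_at ONE_ahead (cds m.1 m.2 w).
Proof.
move=> [P [tc ltP leA]] nf; have [sw Pl _ _] := tc.
have P0 : P != set0 by rewrite -card_gt0; lia.
have [PE | nPE] := eqVneq P (live n w); last first.
  have [p pP [q qD cpq]] := twin_clique_connected tc P0 nPE.
  by exists (val p, val q); split=> //=; exact: (ONE_move_outside tc ltP leA pP qD cpq).
rewrite PE in tc; rewrite PE setDv cards0 addn0 in leA.
have l1 : 1 < #|live n w|.
  rewrite ltnNge; apply/negP => l1; apply: nf => p q; apply/negP => cpq.
  have [x [y [ex ey]]] := compatible_ord sw cpq; subst p q.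
  by have := card_live_cds sw cpq; lia.
have [x [y [cxy aw]]] := ONE_move_clique tc leA l1.
by exists (val x, val y).
Qed.

End Game.

(** * The initial position *)

Lemma perm_oneline n (pi : 'S_n) : perm_eq (oneline pi) (iota 1 n).
Proof.
have -> : iota 1 n = [seq (val i).+1 | i <- enum 'I_n].
  by rewrite -[1]/(1 + 0) iotaDl -val_enum_ord -map_comp.
have -> : oneline pi = [seq (val i).+1 | i <- [seq pi j | j <- enum 'I_n]].
  by rewrite -map_comp.
apply: perm_map; apply: uniq_perm; rewrite ?(map_inj_uniq perm_inj) ?enum_uniq //.
move=> i; rewrite mem_enum; apply/mapP.
by exists (pi^-1%g i); rewrite ?mem_enum ?permKV.
Qed.

Lemma part_of_adjacency_fixed n w r : perm_eq w (iota 1 n) -> is_pointer n r ->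
  part_of_adjacency w r -> C_perm w r = r.
Proof.
move=> pw /andP[r0 ltr] /infixP[s [t wE]]; apply/eqP.
rewrite (C_permE pw) ?(ltnW ltr) // (lposE pw) // /rpos /= (ltn_eqF r0).
have := word_uniq pw; rewrite {1}wE cat_uniq => /and3P[_ /hasPn ns _].
have nr := ns r; rewrite /= in nr; have nr1 := ns r.+1; rewrite /= in nr1.
rewrite wE !index_cat (negbTE (nr _)) ?(negbTE (nr1 _)) ?inE ?eqxx ?orbT //=.
by rewrite (ltn_eqF (ltnSn r)) !eqxx addn0 addn1.
Qed.

(** A member [x] rules out the default empty pile, so the trajectory of [n] reaches [0], for the
    first time at [i0]; the pile lies strictly in between. *)
Lemma strategic_seqP n w x : perm_eq w (iota 1 n) ->
  x \in strategic_seq w -> exists2 i0,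
  iter i0 (C_perm w) n = 0 /\ (forall i, i < i0 -> iter i (C_perm w) n != 0) &
  forall y, y \in strategic_seq w <-> exists2 i, 0 < i < i0 & iter i (C_perm w) n = y.
Proof.
move=> pw; rewrite /strategic_seq (word_size pw).
set s := traject _ _ _; case: ifP => // s0 _.
have lt0 : index 0 s < n.+1.
  by rewrite -(size_traject (C_perm w) n n.+1) index_mem.
exists (index 0 s).
  split=> [|i lti]; first by rewrite -(nth_traject _ lt0) nth_index.
  by rewrite -(nth_traject _ (ltn_trans lti lt0)) -/s; have /= -> := before_find n lti.
have szE : size (take (index 0 s) s) = index 0 s by rewrite size_takel // index_size.
have nE i : i < index 0 s -> nth 0 (take (index 0 s) s) i = iter i (C_perm w) n.
  move=> lti; rewrite (set_nth_default n) ?szE // nth_take //.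
  by rewrite nth_traject // (ltn_trans lti).
move=> y; split=> [/(nthP 0)[j] | [[|i] // lti <-]].
  rewrite size_behead szE nth_behead => ltj <-; have ltj1 : j.+1 < index 0 s by lia.
  by exists j.+1; rewrite ?nE.
apply/(nthP 0); exists i; first by rewrite size_behead szE; lia.
by rewrite nth_behead nE.
Qed.

(** An adjacency is a fixed pointer, so condition (3) puts every moved pointer on the path from [n]
    to [0]. *)
Lemma strategic_pile_single_cycle n (pi : 'S_n) :
  SP pi != set0 ->
  (forall p : 'I_n.+1, p \in pointers n ->
     ~~ part_of_adjacency (oneline pi) p -> p \in SP pi) ->
  single_cycle n (oneline pi) /\ SP pi = live n (oneline pi).
Proof.
move=> /set0Pn[x0]; rewrite inE => x0SP adj.
have pw := perm_oneline pi; set w := oneline pi in x0SP adj pw *.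
have [i0 [e0 min0] SPE] := strategic_seqP pw x0SP.
have [j0 /andP[j0_gt0 ltj0] _] := (SPE x0).1 x0SP.
have leC i : iter i (C_perm w) n <= n by elim: i => //= i /(C_perm_le pw).
have liveSP (x : 'I_n.+1) : x \in live n w -> x \in SP pi.
  rewrite !inE => /andP[xp nC]; have := adj x; rewrite !inE; apply=> //.
  by apply: contra nC => /(part_of_adjacency_fixed pw xp) ->.
have SPpos (x : 'I_n.+1) : x \in SP pi -> exists2 i, 0 < i < i0 & iter i (C_perm w) n
  = x.
  by rewrite inE => /SPE.
have n0 : 0 < n by rewrite lt0n; apply: (min0 0); lia.
have prednC i : i < i0 -> C_perm w 0 <> iter i.+1 (C_perm w) n.
  move=> lti /(C_perm_inj pw (leq0n n) (leC i)) e; have := min0 i lti.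
  by rewrite -e.
have nC0 : C_perm w 0 <> 0.
  by move=> C0; apply: (prednC i0.-1); rewrite ?prednK ?e0 //; lia.
(* Otherwise the image of [0] would be a live pointer, hence on the path, where its predecessor is
   not [0]; this contradicts injectivity. *)
have C0n : C_perm w 0 = n.
  apply/eqP; apply: contraT => ne; have leC0 := C_perm_le pw (leq0n n).
  have yl : @Ordinal n.+1 (C_perm w 0) leC0 \in live n w.
    rewrite !inE /is_pointer /= lt0n ltn_neqAle ne leC0 !andbT.
    apply/andP; split; first exact/eqP.
    by apply/eqP => /(C_perm_inj pw leC0 (leq0n n)).
  have [[|i] // lti ei] := SPpos _ (liveSP _ yl).
  by case: (prednC i) => //; lia.
have SPlive (x : 'I_n.+1) : x \in SP pi -> x \in live n w.
  move=> /SPpos[i lti ei].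
  have xn : x != n :> nat.
    (* A return to [n] at time [i] would make the path reach [0] already at time [i0 - i]. *)
    apply/eqP => xn; have lt_i : i0 - i < i0 by lia.
    by have := min0 _ lt_i; rewrite -{1}xn -ei -iterD subnK ?e0 //; lia.
  have lt_i0 : i < i0 by lia.
  have x_neq0 := min0 i lt_i0; rewrite ei in x_neq0.
  rewrite !inE /is_pointer lt0n x_neq0 /= ltn_neqAle xn -ltnS ltn_ord /=.
  apply/eqP => Cx; have : iter (i0 - i) (C_perm w) x = x.
    by elim: (i0 - i) => //= m ->.
  rewrite -{1}ei -iterD subnK ?(ltnW lt_i0) // e0 => e.
  by rewrite -e in x_neq0.
split; last by apply/setP => x; apply/idP/idP; [apply: SPlive | apply: liveSP].
split=> // x lex.
have [Cx|nC] := eqVneq (C_perm w x) x; [by left | right].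
have [->|x_neq0] := eqVneq x 0; first by exists 0.
have [->|xn] := eqVneq x n; first by exists i0.
have xl : @Ordinal n.+1 x lex \in live n w.
  by rewrite !inE /is_pointer /= lt0n x_neq0 ltn_neqAle xn lex nC.
have [i lti /= <-] := SPpos _ (liveSP _ xl).
by exists (i0 - i); rewrite -iterD subnK //; lia.
Qed.

Theorem theorem5p17 (n : nat) (pi : 'S_n) (P A : {set 'I_n.+1}) (k c : nat) :
  P \subset pointers n ->
  good P pi ->
  #|SP pi| = k ->
  c = k - #|P| ->
  #|P| > 3 * c ->
  A \subset SP pi ->
  #|A| >= k %/ 2 + 1 + 2 * c ->
  ONE_has_winning_strategy pi A.
Proof.
move=> Pp [cl tw adj] kE cE ltP AS leA; set w := oneline pi in cl tw adj.
(* The lower bound on [#|A|] is at least 1. *)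
have SP0 : SP pi != set0.
  by rewrite -card_gt0; have := subset_leq_card AS; lia.
have [sw SPl] := strategic_pile_single_cycle SP0 adj.
rewrite -/w in sw SPl; rewrite SPl in kE AS; have AI := setIidPl AS.
suff ahead : ONE_ahead A w.
  exists (fun h => move_for (ONE_wins_at A) (ONE_ahead A) (position w h)) => h lh fh.
  exact: (strategy_wins (@ONE_ahead_win n A) (@ONE_ahead_move n A) ahead lh fh).
(* A single pointer of [P] has no partner in [P] to make it live. But then [3 * c < #|P|] gives
   [c = 0] and one live pointer, which serves as the clique. *)
have [P1 | P1] := leqP #|P| 1.
  have l0 := live_neq0 sw; rewrite -card_gt0 in l0.
  have /eqP/cards1P[a la] : #|live n w| = 1 by lia.
  exists (live n w); rewrite setDv cards0 AI; split=> //; last by lia.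
  split=> // [x y | x y r]; rewrite la !in_set1 => /eqP-> /eqP->; first by rewrite eqxx.
  by [].
have Pl : P \subset live n w.
  apply/subsetP => x xP.
  have [y] : exists y, y \in P :\ x.
    by apply/set0Pn; rewrite -card_gt0; have := cardsD1 x P; rewrite xP; lia.
  rewrite in_setD1 => /andP[nyx yP].
  by case: (compatible_live sw (cl y x yP xP nyx)).
have cD := cardsD (live n w) P; rewrite (setIidPr Pl) kE -cE in cD.
exists P; rewrite cD kE AI; split=> //; split=> // x y r xP yP rl.
by apply: tw => //; move: rl; rewrite !inE => /andP[].
Qed.
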